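(* There exists $R > 1$ such that $\{z \in \mathbb{C} : R^{-1} < |z| < R\} \subseteq \Sigma$.
   Context: For $c \in [-2,1/4]$ let $f_c(z) := z^2 + c$. The growth rate of $f_c$ is $s(f_c) := e^{h(f_c)}$, where $h(f_c)$ is the topological entropy of $f_c$ as a real interval map (i.e. restricted to its compact invariant interval $[-\beta,\beta]$, $\beta = (1+\sqrt{1-4c})/2$). The map $f_c$ is called superattracting if the critical point $0$ is periodic under $f_c$; $M_0$ denotes the set of superattracting parameters. For an algebraic number $\lambda$, $Gal(\lambda) \subset \mathbb{C}$ denotes the set of roots of its minimal polynomial. The entropy spectrum is $$\Sigma := \overline{\bigcup_{c \in M_0 \cap \mathbb{R}} Gal(s(f_c))} \subset \mathbb{C}.$$ *)

(* Defs.v *)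
From HB Require Import structures.
From mathcomp Require Import all_boot all_order all_algebra finmap complex.
From mathcomp Require Import all_classical all_reals all_analysis.

Set Implicit Arguments.
Unset Strict Implicit.
Unset Printing Implicit Defensive.

Import Order.TTheory GRing.Theory Num.Theory.
Import numFieldNormedType.Exports.

Local Open Scope classical_set_scope.
Local Open Scope ring_scope.
Local Open Scope complex_scope.

(* [(n, e)]-separated sets and Bowen's definition of topological entropy.
   [X] is meant to be an [f]-invariant compact set, so that this is the
   entropy of the restriction of [f] to [X]. *)
Definition dyn_separated (R : realType) (T : pseudoMetricType R) (f : T -> T)
    (n : nat) (e : R) (E : {fset T}) : Prop :=
  forall x y : T, x \in E -> y \in E -> x != y ->
    exists2 k : nat, (k < n)%N & ~ ball (iter k f x) e (iter k f y).

Definition separated_number (R : realType) (T : pseudoMetricType R)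
    (f : T -> T) (X : set T) (n : nat) (e : R) : \bar R :=
  ereal_sup [set (#|` E|%:R)%:E | E in
    [set E : {fset T} | [set` E] `<=` X /\ dyn_separated f n e E]].

(* The limit as [e] tends to [0+] is a supremum, because [separated_number]
   is nonincreasing in [e]. *)
Definition topological_entropy (R : realType) (T : pseudoMetricType R)
    (f : T -> T) (X : set T) : \bar R :=
  ereal_sup [set limn_esup (fun n : nat =>
      ((n%:R^-1)%:E * lne (separated_number f X n e))%E) | e in
    [set e : R | 0 < e]].

Definition quad (R : realType) (c z : R) : R := z ^+ 2 + c.

Definition quad_beta (R : realType) (c : R) : R :=
  (1 + Num.sqrt (1 - 4 * c)) / 2.

Definition quad_interval (R : realType) (c : R) : set R :=
  [set` `[- quad_beta c, quad_beta c]].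

Definition quad_entropy (R : realType) (c : R) : \bar R :=
  topological_entropy (quad c) (quad_interval c).

(* [fine] is harmless: the entropy of [quad c] lies in [0, ln 2]. *)
Definition growth_rate (R : realType) (c : R) : R :=
  expR (fine (quad_entropy c)).

Definition superattracting (R : realType) (c : R) : Prop :=
  exists2 n : nat, (0 < n)%N & iter n (quad c) 0 = 0.

Definition real_superattracting_parameters (R : realType) : set R :=
  [set c : R | -2 <= c <= 1 / 4 /\ superattracting c].
Arguments real_superattracting_parameters R : clear implicits.

Definition is_min_poly (F : fieldType) (x : F) (p : {poly rat}) : Prop :=
  [/\ p \is monic, root (map_poly ratr p) x &
      forall q : {poly rat}, q != 0 -> root (map_poly ratr q) x ->
        (size p <= size q)%N].

(* Empty when [x] is not algebraic over the rationals. *)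
Definition galois_conjugates (F : fieldType) (x : F) : set F :=
  [set z : F | exists2 p : {poly rat},
    is_min_poly x p & root (map_poly ratr p) z].

(* The type [R[i]^o] is [R[i]] with the topology of its norm. *)
Definition entropy_spectrum (R : realType) : set R[i]^o :=
  closure (\bigcup_(c in real_superattracting_parameters R)
    (galois_conjugates (growth_rate c)%:C : set R[i]^o)).
Arguments entropy_spectrum R : clear implicits.

(* Main.v *)
Require Import Defs.
From mathcomp Require Import all_boot all_order all_algebra finmap complex.
From mathcomp Require Import all_classical all_reals all_analysis.
From mathcomp Require Import ring lra zify.

Set Implicit Arguments.
Unset Strict Implicit.
Unset Printing Implicit Defensive.

Import Order.TTheory GRing.Theory Num.Theory.
Import numFieldNormedType.Exports.
Import ComplexField.Normc.

Local Open Scope classical_set_scope.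
Local Open Scope ring_scope.
Local Open Scope complex_scope.

(** The entropy spectrum contains the roots of many polynomials with
    coefficients 1 and -1, and these roots are dense near the unit circle.

    Write a word of signs as a_0, ..., a_(p-1), with a_0 = 1, and suppose that
    it is dominant: after a_0 comes a run of minus signs at least three times
    as long as any later run.  Such a word is the kneading data of a
    superattracting parameter c close to -2 ([quad_parameter]) and of a tent
    map of slope 1/t, where t is a root of P = sum_k a_k X^k ([tent_orbit]).
    The two critical orbits are ordered in the same way on the line, so the
    kneading function [theta], which would semiconjugate the quadratic map to
    the tent map, is strictly increasing on the critical orbit.  As its
    increments are multiplied exactly by 1/t along each branch, up to sign,
    consecutive turning points of
    the n-th iterate are at a [theta]-distance comparable to t^n
    ([theta_gap]), hence there are about t^(-n) turning points.  The turning
    points are themselves uniformly separated orbits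
    ([turning_points_separated]), while on each lap only O(n) points can be
    separated ([separated_card_le]); so the growth rate is exactly 1/t
    ([growth_rate_kneading]).

    When p is a power of 2, P is a power of X - 1 modulo 2.  If moreover P(1)
    is not divisible by 4, the argument of Eisenstein's criterion shows that
    the reversed polynomial X^(p-1) P(1/X), which is monic and has 1/t as a
    root, is irreducible ([sign_poly_irreducible]), and all its roots are
    conjugates of the growth rate ([kneading_conjugates]).  The condition on
    P(1) costs one free sign.

    It remains to place roots of these polynomials near a given z.  If |z| > 1
    the beginning of the word matters: P should have a root near 1/z.  If
    |z| < 1 it is its end: the reversed polynomial, whose low coefficients are
    the last signs, should have a root near z.  Both follow from a power
    series with coefficients 1 and -1, short runs and a zero at the given
    point w of the unit disc, because polynomials of growing degree that agree
    with a power series up to a bounded number of top coefficients acquire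
    roots near its zeros ([root_approx]): otherwise they would be
    exponentially small on a whole disc, and the series would vanish
    identically.

    Such a series exists for |w| close to 1 ([sign_series_zeros]).  If w is
    close to 1, the tails of the series, written in the basis 1, w - 1 with
    real coordinates, form a perturbed double integrator driven by the signs,
    and a feedback rule keeps it bounded ([steering]).  In general some
    bounded power w^m is close to 1 ([dirichlet_power]), and m series in w^m
    are interleaved. *)

(** Arithmetic on indices in a context full of real inequalities, which would
    otherwise all be preprocessed. *)
Ltac nlia := repeat match goal with
  | H : context [@Order.le] |- _ => clear H
  | H : context [@Order.lt] |- _ => clear H
  | H : context [@GRing.exp] |- _ => clear H
  | H : context [@GRing.mul] |- _ => clear H
  | H : context [@GRing.one] |- _ => clear H
  | H : context [@Algebra.zero] |- _ => clear H
  | H : context [@Algebra.opp] |- _ => clear H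
  end; lia.

(** * Irreducibility of polynomials with coefficients 1 and -1 *)

Definition sign_poly (K : nzRingType) (a : nat -> bool) (p : nat) : {poly K} :=
  \poly_(k < p) (-1) ^+ a k.

Lemma coef_sign_poly (K : nzRingType) a p k :
  (sign_poly K a p)`_k = if (k < p)%N then (-1) ^+ a k else 0.
Proof. exact: coef_poly. Qed.

Lemma size_sign_poly (K : nzRingType) a p : size (sign_poly K a p) = p.
Proof.
case: p => [|p]; first by rewrite /sign_poly poly_def big_ord0 size_poly0.
by rewrite size_poly_eq //= signr_eq0.
Qed.

Lemma lead_coef_sign_poly (K : nzRingType) a p :
  lead_coef (sign_poly K a p.+1) = (-1) ^+ a p.
Proof. by rewrite lead_coefE size_sign_poly coef_sign_poly /= ltnSn. Qed.

Lemma map_sign_poly (K L : nzRingType) (f : {rmorphism K -> L}) a p :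
  map_poly f (sign_poly K a p) = sign_poly L a p.
Proof.
apply/polyP => k; rewrite coef_map !coef_sign_poly.
case: ifP => _; [exact: (rmorph_sign f) | exact: rmorph0].
Qed.

(** Modulo 2 all signs are 1, so that (X - 1) P = X^(2^n) - 1, which is the
    Frobenius image of X - 1. *)
Lemma sign_poly_mod2 a n :
  sign_poly 'F_2 a (2 ^ n) = ('X - 1%:P) ^+ (2 ^ n).-1.
Proof.
have X1n0 : 'X - 1%:P != 0 :> {poly 'F_2} by rewrite polyXsubC_eq0.
apply: (mulfI X1n0); rewrite -exprS prednK ?expn_gt0 //.
have ch : 2%N \in [pchar {poly 'F_2}] by rewrite pchar_poly pchar_Fp.
have -> : ('X - 1%:P : {poly 'F_2}) ^+ (2 ^ n) = 'X^(2 ^ n) - 1.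
  elim: n => [|n IHn]; first by rewrite !expn0 !expr1 polyC1.
  rewrite expnS mulnC exprM IHn -!(pFrobenius_autE ch) rmorphB rmorph1.
  by rewrite /= pFrobenius_autE -exprM.
rewrite subrX1 polyC1; congr (_ * _).
rewrite /sign_poly poly_def; apply: eq_bigr => i _.
by rewrite oppr_pchar2 ?pchar_Fp // expr1n scale1r.
Qed.

(** Modulo 2 a factor divides a power of X - 1, and its degree does not drop
    because the leading coefficients are units; so it has the root 1. *)
Lemma sign_poly_factor_even a n (r s : {poly int}) :
  sign_poly int a (2 ^ n) = r * s -> (1 < size r)%N ->
  (2 %| r.[1])%Z.
Proof.
move=> Prs szr.
have uP : lead_coef r * lead_coef s \is a GRing.unit.
  rewrite -lead_coefM -Prs -(@prednK (2 ^ n)) ?expn_gt0 //.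
  by rewrite lead_coef_sign_poly unitrX ?unitrN1.
have ur : lead_coef r \is a GRing.unit.
  by move: uP; rewrite unitrM => /andP[].
pose f : {rmorphism int -> 'F_2} := intr.
have szfr : (1 < size (map_poly f r))%N.
  by rewrite size_map_poly_id0 // -unitfE rmorph_unit.
have: map_poly f r %| ('X - 1%:P) ^+ (2 ^ n).-1.
  by rewrite -(sign_poly_mod2 a) -(map_sign_poly f) Prs rmorphM dvdp_mulIl.
case/dvdp_exp_XsubCP => k _ eqk.
have k0 : (0 < k)%N.
  case: k eqk => // /eqp_size; rewrite expr0 size_poly1 => e.
  by rewrite e in szfr.
have: root (map_poly f r) 1.
  by rewrite (eqp_root eqk) -(prednK k0) root_exp_XsubC.
rewrite rootE -(rmorph1 f) horner_map /= -(dvdz_pcharf (pchar_Fp _)) //.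
Qed.

(** Two factors of positive degree would both be even at 1. *)
Lemma sign_poly_irreducible a n : (0 < n)%N ->
  ~~ (4 %| (sign_poly int a (2 ^ n)).[1])%Z ->
  irreducible_poly (sign_poly rat a (2 ^ n)).
Proof.
move=> n0 n4.
pose f : {rmorphism int -> rat} := intr.
rewrite -(map_sign_poly f).
split; first by rewrite size_rat_int_poly size_sign_poly -(expn0 2) ltn_exp2l.
move=> q szq /dvdpP_rat_int[r [c c0 qE] [s Prs]].
have szr : size r != 1%N.
  by rewrite -size_rat_int_poly -(size_scale _ c0) -qE.
have P0 : sign_poly int a (2 ^ n) != 0.
  by rewrite -size_poly_gt0 size_sign_poly expn_gt0.
have r0 : r != 0 by apply: contraNneq P0 => r0; rewrite Prs r0 mul0r.
have s0 : s != 0 by apply: contraNneq P0 => s0; rewrite Prs s0 mulr0.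
have szr1 : (1 < size r)%N by rewrite ltn_neqAle eq_sym szr size_poly_gt0.
have even_r := sign_poly_factor_even Prs szr1.
have szs : (size s <= 1)%N.
  rewrite leqNgt; apply/negP => szs1; move/negP: n4; apply.
  rewrite Prs hornerM (_ : 4 = 2 * 2) //; apply: dvdz_mul => //.
  by apply: (@sign_poly_factor_even a n s r) => //; rewrite mulrC.
have /eqP szs1 : size s == 1%N by rewrite eqn_leq szs size_poly_gt0.
move/eqP: szs1 => /size_poly1P[d d0 sE].
rewrite qE (eqp_ltrans (eqp_scale _ c0)) Prs sE rmorphM /= map_polyC /=.
by rewrite mulrC mul_polyC eqp_sym eqp_scale ?intr_eq0.
Qed.

(** A nonzero polynomial of smaller degree would be coprime to [P] and could
    not share a root with it. *)
Lemma irreducible_min_size (F : numFieldType) (x : F) (P q : {poly rat}) :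
  irreducible_poly P -> root (map_poly ratr P) x -> q != 0 ->
  root (map_poly ratr q) x -> (size P <= size q)%N.
Proof.
move=> irr Px q0 qx; rewrite leqNgt; apply/negP => lt_qP.
have cop : coprimep P q.
  by rewrite irreducible_poly_coprime // gtNdvdp.
move: cop; rewrite -(coprimep_map (ratr : {rmorphism rat -> F})) => /coprimep_root /(_ Px).
by rewrite (rootP qx) eqxx.
Qed.

(** * Partial sums of complex power series *)

Lemma normc_ge0 (R : rcfType) (z : R[i]) : 0 <= normc z.
Proof. by rewrite -lecR; exact: (normr_ge0 z). Qed.

Lemma normc_real (R : rcfType) (x : R) : normc x%:C = `|x|.
Proof. by rewrite /= expr0n addr0 sqrtr_sqr. Qed.

Lemma normc_le_B (R : rcfType) (x y : R[i]) : normc (x - y) <= normc x + normc y.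
Proof. by rewrite -[normc y]normcN; exact: le_normcD. Qed.

Lemma normcBC (R : rcfType) (x y : R[i]) : normc (x - y) = normc (y - x).
Proof. by rewrite -normcN opprB. Qed.

Lemma normc_le_dist (R : rcfType) (x y : R[i]) : normc x <= normc y + normc (x - y).
Proof. by rewrite -[x in leLHS](subrKC y) le_normcD. Qed.

Lemma normcX (R : rcfType) (z : R[i]) n : normc (z ^+ n) = normc z ^+ n.
Proof. by elim: n => [|n IHn]; rewrite ?expr0 ?normc1 // !exprS normcM IHn. Qed.

Lemma normc_sum (R : rcfType) n (F : 'I_n -> R[i]) :
  normc (\sum_(i < n) F i) <= \sum_(i < n) normc (F i).
Proof.
elim: n F => [|n IHn] F; first by rewrite !big_ord0 normc0.
rewrite !big_ord_recr /= (le_trans (le_normcD _ _)) // lerD2r; exact: IHn.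
Qed.

Lemma normc_eq0 (R : rcfType) (z : R[i]) : (normc z == 0) = (z == 0).
Proof. by apply/eqP/eqP => [/eq0_normc|->] //; rewrite normc0. Qed.

Lemma normc_gt0 (R : rcfType) (z : R[i]) : (0 < normc z) = (z != 0).
Proof. by rewrite lt_neqAle eq_sym normc_ge0 andbT normc_eq0. Qed.

Lemma expr_small (R : realType) (r A e : R) : 0 <= r < 1 -> 0 < e ->
  exists N, forall n, (N <= n)%N -> A * r ^+ n <= e.
Proof.
move=> /andP[r0 r1] e0.
have A0 : 0 < `|A| + 1 by rewrite ltr_wpDl.
have := @cvg_geometric R (`|A| + 1) r; rewrite ger0_norm // => /(_ r1).
move=> /cvgrPdist_le/(_ e e0)[N _ HN]; exists N => n Nn.
have := HN n Nn; rewrite /= sub0r normrN /= => h.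
apply: le_trans h; rewrite normrM; rewrite (ger0_norm (exprn_ge0 _ r0)).
rewrite ler_wpM2r ?exprn_ge0 // (ger0_norm (ltW A0)).
by rewrite (le_trans (ler_norm A)) // lerDl.
Qed.

Lemma geom_tail_le (R : realType) (r : R) n d : 0 <= r < 1 ->
  \sum_(j < d) r ^+ (n + j) <= r ^+ n / (1 - r).
Proof.
move=> /andP[r0 r1]; under eq_bigr => j _ do rewrite exprD.
rewrite -big_distrr /= ler_wpM2l ?exprn_ge0 //.
rewrite -[leRHS]mul1r ler_pdivlMr ?subr_gt0 //.
rewrite mulrC -[X in X * _]opprB mulNr -subrX1 opprB.
by rewrite lerBlDr lerDl exprn_ge0.
Qed.

Definition psum (R : rcfType) (b : nat -> R[i]) (n : nat) (z : R[i]) : R[i] :=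
  \sum_(j < n) b j * z ^+ j.

Lemma psumS (R : rcfType) (b : nat -> R[i]) n z :
  psum b n.+1 z = psum b n z + b n * z ^+ n.
Proof. by rewrite /psum big_ord_recr. Qed.

Lemma psumD_le (R : realType) (b : nat -> R[i]) K n d (z : R[i]) :
  (forall j, normc (b j) <= K) -> normc z < 1 ->
  normc (psum b (n + d) z - psum b n z) <= K / (1 - normc z) * normc z ^+ n.
Proof.
move=> bK z1; rewrite /psum big_split_ord /= [X in normc (X - _)]addrC addrK.
have K0 : 0 <= K := le_trans (normc_ge0 _) (bK 0).
apply: (le_trans (normc_sum _)).
apply: (@le_trans _ _ (\sum_(j < d) K * normc z ^+ (n + j))).
  by apply: ler_sum => j _; rewrite normcM normcX ler_wpM2r ?exprn_ge0 ?normc_ge0.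
rewrite -big_distrr /= -mulrA ler_wpM2l // mulrC.
by rewrite (geom_tail_le n d) // normc_ge0 z1.
Qed.

Lemma psum_le (R : realType) (b : nat -> R[i]) K n (z : R[i]) :
  (forall j, normc (b j) <= K) -> normc z < 1 ->
  normc (psum b n z) <= K / (1 - normc z).
Proof.
move=> bK z1; have := psumD_le 0 n bK z1.
by rewrite add0n expr0 mulr1 {2}/psum big_ord0 subr0.
Qed.

(** Upper limits of the moduli of the partial sums, without assuming that the
    series converges. *)
Definition psum_limsup_le (R : rcfType) (b : nat -> R[i]) (z : R[i]) (A : R) :=
  forall e, 0 < e -> exists N, forall n, (N <= n)%N -> normc (psum b n z) <= A + e.

Definition vanishes (R : rcfType) (b : nat -> R[i]) (z : R[i]) :=
  psum_limsup_le b z 0.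

(** A series with bounded coefficients that is small along arbitrarily large
    partial sums vanishes, with an explicit rate given by its geometric tail. *)
Lemma vanishes_cofinal (R : realType) (b : nat -> R[i]) K (z : R[i]) :
  (forall j, normc (b j) <= K) -> normc z < 1 ->
  (forall e n, 0 < e -> exists2 m, (n <= m)%N & normc (psum b m z) <= e) ->
  forall n, normc (psum b n z) <= K / (1 - normc z) * normc z ^+ n.
Proof.
move=> bK z1 h n; apply/ler_addgt0Pr => e e0.
have [m nm hm] := h e n e0.
have := psumD_le n (m - n) bK z1; rewrite subnKC // normcBC => h1.
have := normc_le_dist (psum b n z) (psum b m z); lra.
Qed.

Lemma vanishes_le (R : realType) (b : nat -> R[i]) K (z : R[i]) :
  (forall j, normc (b j) <= K) -> normc z < 1 -> vanishes b z ->
  forall n, normc (psum b n z) <= K / (1 - normc z) * normc z ^+ n.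
Proof.
move=> bK z1 bz; apply: vanishes_cofinal => // e n e0.
have [N HN] := bz e e0; exists (maxn n N); first exact: leq_maxl.
by rewrite (le_trans (HN _ (leq_maxr _ _))) // add0r.
Qed.

Lemma le_vanishes (R : realType) (b : nat -> R[i]) K (z : R[i]) : normc z < 1 ->
  (forall n, normc (psum b n z) <= K * normc z ^+ n) -> vanishes b z.
Proof.
move=> z1 h e e0; have [|N HN] := @expr_small R (normc z) K e _ e0.
  by rewrite normc_ge0 z1.
by exists N => n Nn; rewrite add0r (le_trans (h n)) ?HN.
Qed.

(** The coefficients of the quotient of the series by z - x, when it vanishes
    at x. *)
Definition squot (R : rcfType) (b : nat -> R[i]) (x : R[i]) (j : nat) : R[i] :=
  - psum b j.+1 x / x ^+ j.+1.

Lemma psum_squot (R : rcfType) (b : nat -> R[i]) (x : R[i]) n z : x != 0 ->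
  psum b n.+1 z = (z - x) * psum (squot b x) n z - x * squot b x n * z ^+ n.
Proof.
move=> x0.
have b0 : b 0%N = - x * squot b x 0%N.
  by rewrite /squot psumS /psum big_ord0 add0r expr0 mulr1 expr1 mulNr mulrCA divff // mulr1 opprK.
have bS k : b k.+1 = squot b x k - x * squot b x k.+1.
  have xk : x ^+ k.+1 != 0 by rewrite expf_neq0.
  rewrite /squot [psum b k.+2 x]psumS [x ^+ k.+2]exprS.
  by move: xk; set p := x ^+ k.+1 => xk; field; rewrite xk x0.
elim: n => [|n IHn].
  by rewrite psumS /psum !big_ord0 mulr0 sub0r add0r b0 !mulNr.
rewrite psumS IHn bS [psum _ n.+1 z]psumS exprS; ring.
Qed.

(** Dividing by z - x multiplies the bound of the coefficients by at most
    1 / (1 - |x|).  This loss is compared with the gain |z - x| in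
    [limsup_zeros]. *)
Lemma squot_le (R : realType) (b : nat -> R[i]) K (x : R[i]) : x != 0 -> normc x < 1 ->
  (forall j, normc (b j) <= K) -> vanishes b x ->
  forall j, normc (squot b x j) <= K / (1 - normc x).
Proof.
move=> x0 x1 bK bx j; rewrite /squot normcM normcN normcV normcX.
rewrite ler_pdivrMr ?exprn_gt0 ?normc_gt0 //.
exact: vanishes_le.
Qed.

Lemma limsup_squot (R : realType) (b : nat -> R[i]) K (x z : R[i]) A :
  x != 0 -> normc x < 1 -> normc z < 1 -> 0 <= A ->
  (forall j, normc (b j) <= K) -> vanishes b x ->
  psum_limsup_le (squot b x) z A -> psum_limsup_le b z (normc (z - x) * A).
Proof.
move=> x0 x1 z1 A0 bK bx h e e0.
have e2 : 0 < e / 2 by rewrite divr_gt0.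
have d0 : 0 < normc (z - x) + 1 by rewrite ltr_wpDl ?normc_ge0.
have [N1 H1] := h (e / 2 / (normc (z - x) + 1)) (divr_gt0 e2 d0).
have [|N2 H2] := @expr_small R (normc z) (normc x * (K / (1 - normc x))) _ _ e2.
  by rewrite normc_ge0 z1.
exists (maxn N1 N2).+1 => -[//|n]; rewrite ltnS geq_max => /andP[n1 n2].
rewrite (psum_squot _ _ _ x0) (le_trans (normc_le_B _ _)) //.
rewrite [normc ((z - x) * _)]normcM.
have {H1}h1 := H1 n n1; have {H2}h2 := H2 n n2.
have h3 : normc (x * squot b x n * z ^+ n) <= e / 2.
  rewrite [normc (_ * z ^+ n)]normcM [normc (x * _)]normcM normcX.
  apply: le_trans h2; rewrite ler_wpM2r ?exprn_ge0 ?normc_ge0 //.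
  by rewrite ler_wpM2l ?normc_ge0 //; exact: squot_le.
have h4 : normc (z - x) * normc (psum (squot b x) n z) <=
          normc (z - x) * A + e / 2.
  apply: (le_trans (ler_wpM2l (normc_ge0 _) h1)).
  rewrite mulrDr lerD2l mulrA ler_pdivrMr // mulrC mulrDr mulr1 lerDl.
  exact: ltW.
by rewrite (le_trans (lerD h4 h3)) //; lra.
Qed.

Lemma vanishes_squot (R : realType) (b : nat -> R[i]) K (x z : R[i]) :
  x != 0 -> normc x < 1 -> normc z < 1 -> z != x ->
  (forall j, normc (b j) <= K) -> vanishes b x -> vanishes b z ->
  vanishes (squot b x) z.
Proof.
move=> x0 x1 z1 zx bK bx bz e e0.
have d0 : 0 < normc (z - x) by rewrite normc_gt0 subr_eq0.
have e2 : 0 < e * normc (z - x) / 2 by rewrite divr_gt0 // mulr_gt0.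
have [N1 H1] := bz _ e2.
have [|N2 H2] := @expr_small R (normc z) (normc x * (K / (1 - normc x))) _ _ e2.
  by rewrite normc_ge0 z1.
exists (maxn N1 N2) => n; rewrite geq_max => /andP[n1 n2].
have := H1 n.+1 (leqW n1); rewrite !add0r => h1; have {H2}h2 := H2 n n2.
have h3 : normc (x * squot b x n * z ^+ n) <= e * normc (z - x) / 2.
  rewrite [normc (_ * z ^+ n)]normcM [normc (x * _)]normcM normcX.
  apply: le_trans h2; rewrite ler_wpM2r ?exprn_ge0 ?normc_ge0 //.
  by rewrite ler_wpM2l ?normc_ge0 //; exact: squot_le.
rewrite -(ler_pM2l d0) -normcM.
have -> : (z - x) * psum (squot b x) n z = psum b n.+1 z + x * squot b x n * z ^+ n.
  by rewrite (psum_squot _ _ _ x0) subrK.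
rewrite (le_trans (le_normcD _ _)) //.
by rewrite (le_trans (lerD h1 h3)) //; lra.
Qed.

(** Dividing out the zeros in turn gains |z - x| and loses 1 / (1 - |x|) for
    each zero x. *)
Lemma limsup_zeros (R : realType) (s : seq R[i]) (b : nat -> R[i]) K q z :
  (forall j, normc (b j) <= K) -> uniq s -> normc z < 1 -> 0 <= q ->
  (forall x, x \in s ->
     [/\ x != 0, normc x < 1, vanishes b x & normc (z - x) <= q * (1 - normc x)]) ->
  psum_limsup_le b z (q ^+ size s * (K / (1 - normc z))).
Proof.
elim: s b K => [|x s IHs] b K bK us z1 q0 hs.
  move=> e e0; exists 0%N => n _; rewrite expr0 mul1r.
  by rewrite (le_trans (psum_le n bK z1)) // lerDl ltW.
have K0 : 0 <= K := le_trans (normc_ge0 _) (bK 0).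
case/andP: us => xs us.
have [x0 x1 bx zx] := hs x (mem_head _ _).
have x1' : 0 < 1 - normc x by rewrite subr_gt0.
have z1' : 0 < 1 - normc z by rewrite subr_gt0.
have h : psum_limsup_le (squot b x) z
    (q ^+ size s * (K / (1 - normc x) / (1 - normc z))).
  apply: (IHs _ _ (squot_le x0 x1 bK bx) us z1 q0) => y ys.
  have [y0 y1 by' zy] := hs y (mem_behead (ys : y \in behead (x :: s))).
  split; [exact: y0 | exact: y1 | | exact: zy].
  apply: (vanishes_squot x0 x1 y1 _ bK bx by').
  by apply: contraNneq xs => <-.
have A0 : 0 <= q ^+ size s * (K / (1 - normc x) / (1 - normc z)).
  by rewrite mulr_ge0 ?exprn_ge0 // !divr_ge0 // ltW.
move=> e e0; have [N HN] := limsup_squot x0 x1 z1 A0 bK bx h e0.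
exists N => n Nn; rewrite (le_trans (HN n Nn)) // lerD2r exprS.
apply: (le_trans (ler_wpM2r A0 zx)).
rewrite [K / (1 - normc x)]mulrC le_eqVlt; apply/orP; left; apply/eqP.
by field; rewrite !gt_eqF.
Qed.

(** * The identity theorem and roots of approximating polynomials *)

(** Take many zeros close to [p]: each contributes a factor at most 5/7 in
    [limsup_zeros].  So vanishing near a point spreads to a disc whose radius
    depends only on the distance to the unit circle. *)
Lemma vanishes_disc (R : realType) (b : nat -> R[i]) K (p z : R[i]) eta sigma :
  (forall j, normc (b j) <= K) -> p != 0 -> 0 < eta ->
  0 < sigma <= 1 - normc p ->
  (forall w, normc (w - p) < eta -> normc w < 1 -> vanishes b w) ->
  normc (z - p) <= sigma / 2 -> vanishes b z.
Proof.
move=> bK p0 eta0 /andP[s0 sp] hp zp.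
have K0 : 0 <= K := le_trans (normc_ge0 _) (bK 0).
have np0 : 0 < normc p by rewrite normc_gt0.
have p1 : normc p < 1 by lra.
have z1 : normc z < 1 by have := normc_le_dist z p; lra.
pose h := Num.min (eta / 2) (sigma / 8).
have h0 : 0 < h by rewrite lt_min !divr_gt0.
have [he hs] : h <= eta / 2 /\ h <= sigma / 8.
  by split; rewrite ge_min lexx ?orbT.
pose zi (i : nat) : R[i] := p + p * (h / i.+1%:R)%:C.
have zi_dist i : normc (zi i - p) <= h * normc p.
  rewrite /zi [X in normc (X - _)]addrC addrK normcM normc_real mulrC.
  rewrite ler_wpM2r ?normc_ge0 // ger0_norm ?divr_ge0 ?(ltW h0) //.
  by rewrite ler_pdivrMr // ler_peMr ?(ltW h0) // ler1n.
have zi_dist' i : normc (zi i - p) <= h.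
  by rewrite (le_trans (zi_dist i)) // ler_piMr // ltW.
have zi_inj : injective zi.
  move=> i j /addrI /(mulfI p0) /complexI /(mulfI (lt0r_neq0 h0)).
  by move=> /invr_inj /eqP; rewrite eqr_nat => /eqP [].
have zi1 i : normc (zi i) <= normc p + h.
  by have := normc_le_dist (zi i) p; have := zi_dist' i; lra.
have lim m : psum_limsup_le b z ((5/7) ^+ m * (K / (1 - normc z))).
  pose s := [seq zi i | i <- iota 0 m].
  have -> : m = size s by rewrite size_map size_iota.
  apply: limsup_zeros => //; first by rewrite map_inj_uniq ?iota_uniq.
  move=> x /mapP[i _ ->].
  have zii1 : normc (zi i) < 1 by have := zi1 i; lra.
  split => //.
  - rewrite /zi -[X in X + _]mulr1 -mulrDr mulf_neq0 //.
    rewrite -(rmorph1 (real_complex R)) -rmorphD /= eq_complex /= eqxx andbT.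
    by rewrite gt_eqF // ltr_wpDr // divr_ge0 // ltW.
  - by apply: hp => //; have := zi_dist' i; lra.
  - have := normc_le_dist (z - zi i) (z - p).
    have -> : z - zi i - (z - p) = p - zi i by ring.
    by rewrite [normc (p - _)]normcBC; have := zi_dist' i; have := zi1 i; lra.
move=> e e0.
have e2 : 0 < e / 2 by lra.
have [|m hm] := @expr_small R (5/7) (K / (1 - normc z)) _ _ e2; first by lra.
have [N HN] := lim m _ e2.
exists N => n Nn; have := HN n Nn; have := hm m (leqnn _); rewrite mulrC; lra.
Qed.

(** [vanishes_disc] carries the vanishing from [z0] to 0 in finitely many steps
    along the segment, and at 0 the series is its constant coefficient. *)
Lemma identity_theorem (R : realType) (b : nat -> R[i]) K (z0 : R[i]) eta :
  (forall j, normc (b j) <= K) -> z0 != 0 -> normc z0 < 1 -> 0 < eta ->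
  (forall w, normc (w - z0) < eta -> normc w < 1 -> vanishes b w) ->
  b 0%N = 0.
Proof.
move=> bK z00 z01 eta0 hz.
pose s := 1 - normc z0.
have s0 : 0 < s by rewrite subr_gt0.
have ns0 : 0 < normc z0 by rewrite normc_gt0.
pose n := (Num.bound (4 / s)).+1.
have n0 : 0 < n%:R :> R by rewrite ltr0n.
have hn : n%:R^-1 <= s / 4.
  have : 4 / s <= n%:R.
    have := @archi_boundP R (4 / s); rewrite divr_ge0 ?(ltW s0) // => /(_ isT) h.
    by rewrite (le_trans (ltW h)) // ler_nat leqnSn.
  move=> h; rewrite -[s / 4]invrK lef_pV2 ?posrE ?invr_gt0 ?divr_gt0 //.
  by rewrite invf_div.
(* centers of the discs, from z0 to 0, in steps of length at most s / 4 *)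
pose p (k : nat) : R[i] := z0 * (1 - k%:R / n%:R)%:C.
have pn0 k : (k < n)%N -> p k != 0.
  move=> kn; rewrite mulf_neq0 // eq_complex /= eqxx andbT subr_eq0 eq_sym.
  by rewrite lt_eqF // ltr_pdivrMr // mul1r ltr_nat.
have p_norm k : (k <= n)%N -> normc (p k) <= normc z0.
  move=> kn; rewrite normcM normc_real.
  have k0 : 0 <= k%:R / n%:R :> R by rewrite divr_ge0.
  have k1 : k%:R / n%:R <= 1 :> R by rewrite ler_pdivrMr // mul1r ler_nat.
  by rewrite ger0_norm ?subr_ge0 // ler_piMr ?normc_ge0 // gerBl.
have V k : (k < n)%N -> exists2 e, 0 < e &
   (forall w, normc (w - p k) < e -> normc w < 1 -> vanishes b w).
  elim: k => [_|k IHk kn].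
    by exists eta => // w; rewrite /p mul0r subr0 mulr1; exact: hz.
  have [e e0 he] := IHk (ltnW kn).
  exists (s / 4); first by lra.
  move=> w wp w1; apply: (@vanishes_disc _ b K (p k) w e s) => //.
  - exact/pn0/ltnW.
  - by rewrite s0 /= lerB // p_norm // ltnW // ltnW.
  - have := normc_le_dist (w - p k) (w - p k.+1).
    have -> : w - p k - (w - p k.+1) = - (z0 * (n%:R^-1)%:C).
      rewrite /p -[k.+1]addn1 natrD mulrDl opprD addrA rmorphB /= mulrBr; ring.
    rewrite normcN normcM normc_real ger0_norm ?invr_ge0 //.
    have : normc z0 * n%:R^-1 <= n%:R^-1.
      by rewrite ler_piMl ?invr_ge0 // ltW.
    lra.
have [e e0 he] := V n.-1 (ltnSn _).
have v0 : vanishes b 0.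
  apply: (@vanishes_disc _ b K (p n.-1) 0 e s) => //; first exact: pn0.
    by rewrite s0 lerB // p_norm // leq_pred.
  rewrite sub0r normcN normcM normc_real.
  have -> : 1 - n.-1%:R / n%:R = n%:R^-1 :> R.
    have -> : n.-1%:R = n%:R - 1 :> R by rewrite -(natrB _ (ltn0Sn _)) subn1.
    by rewrite mulrBl divff ?gt_eqF // mul1r opprB addrCA subrr addr0.
  rewrite ger0_norm ?invr_ge0 //.
  have : normc z0 * n%:R^-1 <= n%:R^-1 by rewrite ler_piMl ?invr_ge0 // ltW.
  lra.
apply/eqP; rewrite -normc_eq0 eq_le normc_ge0 andbT.
apply/ler_addgt0Pr => d d0; have [N HN] := v0 d d0.
have := HN N.+1 (leqnSn _); rewrite /psum big_ord_recl expr0 mulr1.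
rewrite big1 ?addr0 // => i _; by rewrite expr0n mulr0.
Qed.

(** Each factor satisfies |z1 - x| <= |z0 - x| (1 + |z1 - z0| / d). *)
Lemma root_free_growth (R : rcfType) (P : {poly R[i]}) (z0 z1 : R[i]) (d : R) :
  0 < d -> (forall x, root P x -> d <= normc (x - z0)) ->
  normc P.[z1] <= normc P.[z0] * (1 + normc (z1 - z0) / d) ^+ (size P).-1.
Proof.
move=> d0 hP; have [r Pr] := closed_field_poly_normal P.
have [P0|P0] := eqVneq P 0; first by rewrite P0 !horner0 normc0 mul0r.
have lc0 : lead_coef P != 0 by rewrite lead_coef_eq0.
have -> : (size P).-1 = size r.
  by rewrite Pr size_scale // size_prod_XsubC.
have {hP} hr x : x \in r -> d <= normc (x - z0).
  move=> xr; apply: hP; rewrite Pr rootZ // root_prod_XsubC //.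
rewrite Pr !hornerZ !normcM -mulrA ler_wpM2l ?normc_ge0 //.
elim: r hr {Pr} => [|x r IHr] hr.
  by rewrite !big_nil !hornerC expr0 mulr1.
rewrite !big_cons !hornerM !normcM exprS mulrACA.
apply: ler_pM; rewrite ?normc_ge0 //; last first.
  by apply: IHr => y yr; apply: hr; rewrite inE yr orbT.
have hx := hr x (mem_head _ _).
rewrite !hornerXsubC mulrDr mulr1.
have := normc_le_dist (z1 - x) (z0 - x).
have -> : z1 - x - (z0 - x) = z1 - z0 by ring.
move=> h.
rewrite (le_trans h) // lerD2l mulrCA ler_peMr ?normc_ge0 //.
by rewrite ler_pdivlMr // mul1r normcBC.
Qed.

(** If no polynomial has a root within [d] of [z0], then their values at [z0],
    of order |z0|^(2^n), control by [root_free_growth] their values on a disc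
    around [z0], which stay exponentially small; so the series vanishes on
    this disc and its constant coefficient is 0. *)
Lemma root_approx (R : realType) (b : nat -> R[i]) (Q : nat -> {poly R[i]})
    (z0 : R[i]) (N0 n0 : nat) (d : R) :
  (forall j, normc (b j) <= 1) -> b 0%N != 0 -> z0 != 0 -> normc z0 < 1 ->
  vanishes b z0 ->
  (forall n, size (Q n) <= 2 ^ n)%N -> (forall n j, normc (Q n)`_j <= 1) ->
  (forall n j, (j + N0 < 2 ^ n)%N -> (Q n)`_j = b j) -> 0 < d ->
  exists2 n, (n0 <= n)%N & exists2 x, root (Q n) x & normc (x - z0) < d.
Proof.
move=> b1 b0 z00 z01 bz szQ Q1 Qb d0.
apply: contrapT => nex.
have noroot n x : (n0 <= n)%N -> root (Q n) x -> d <= normc (x - z0).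
  move=> nn0 rx; rewrite leNgt; apply/negP => lt; apply: nex.
  by exists n => //; exists x.
move/eqP: b0; apply.
pose r := normc z0.
have r0 : 0 < r by rewrite normc_gt0.
have r1 : 0 < 1 - r by rewrite subr_gt0.
(* on this radius the growth factor 1 + eta / d does not compensate |z0| *)
pose eta := d * (1 - r) / 2.
have eta0 : 0 < eta by rewrite divr_gt0 // mulr_gt0.
pose rho := r * (1 + eta / d).
have rho1 : 0 <= rho < 1.
  rewrite /rho /eta; have -> : 1 + d * (1 - r) / 2 / d = 1 + (1 - r) / 2.
    by field; rewrite gt_eqF.
  by apply/andP; split; nra.
have Qdiff n z : (N0 < 2 ^ n)%N -> normc z < 1 ->
  normc ((Q n).[z] - psum b (2 ^ n - N0) z) <= normc z ^+ (2 ^ n - N0) / (1 - normc z).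
  move=> Nn z1; have -> : (Q n).[z] = psum (fun j => (Q n)`_j) (2 ^ n) z.
    by rewrite (horner_coef_wide _ (szQ n)).
  have -> : psum b (2 ^ n - N0) z = psum (fun j => (Q n)`_j) (2 ^ n - N0) z.
    apply: eq_bigr => j _; rewrite Qb //.
    by rewrite addnC -ltn_subRL.
  rewrite -{1}(subnK (ltnW Nn)).
  by rewrite (le_trans (psumD_le _ _ (Q1 n) z1)) // div1r mulrC.
have big n m : exists2 k, (n <= k)%N & (m + N0 < 2 ^ k)%N.
  exists (maxn n (m + N0)); rewrite ?leq_maxl //.
  by rewrite (leq_ltn_trans (leq_maxr n _)) // ltn_expl.
have Qz0 n : (N0 < 2 ^ n)%N ->
  normc (Q n).[z0] <= 2 / (1 - r) / r ^+ N0 * r ^+ (2 ^ n).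
  move=> Nn; have h1 := Qdiff n z0 Nn z01.
  have h2 := vanishes_le b1 z01 bz (2 ^ n - N0).
  have := normc_le_dist (Q n).[z0] (psum b (2 ^ n - N0) z0).
  rewrite -/r in h1 h2 *.
  have -> : 2 / (1 - r) / r ^+ N0 * r ^+ (2 ^ n) = 2 / (1 - r) * r ^+ (2 ^ n - N0).
    rewrite -mulrA; congr (_ * _); rewrite -{1}(subnK (ltnW Nn)) exprD mulrCA mulVf ?mulr1 //.
    by rewrite expf_neq0 // gt_eqF.
  move: h1 h2; rewrite div1r [_ / (1 - r)]mulrC; lra.
apply: (identity_theorem b1 z00 z01 eta0) => w wz w1.
apply: (@le_vanishes _ b (1 / (1 - normc w))) => //.
apply: vanishes_cofinal => // e n e0.
have e2 : 0 < e / 2 by lra.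
have [M1 H1] := @expr_small R rho (2 / (1 - r) / r ^+ N0) _ rho1 e2.
have [|M2 H2] := @expr_small R (normc w) (1 - normc w)^-1 _ _ e2.
  by rewrite normc_ge0.
have [k kn km] := big n0 (maxn n (maxn M1 M2)).
have Nk : (N0 < 2 ^ k)%N by rewrite (leq_ltn_trans _ km) // leq_addl.
have km' : (maxn n (maxn M1 M2) <= 2 ^ k - N0)%N by rewrite leq_subRL ltnW // addnC.
have nk : (n <= 2 ^ k - N0)%N by rewrite (leq_trans _ km') // leq_maxl.
have M1k : (M1 <= 2 ^ k)%N.
  by rewrite (leq_trans _ (leq_subr N0 _)) // (leq_trans _ km') // leq_max leq_maxl orbT.
have M2k : (M2 <= 2 ^ k - N0)%N.
  by rewrite (leq_trans _ km') // leq_max leq_maxr orbT.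
exists (2 ^ k - N0)%N => //.
have h1 := Qdiff k w Nk w1.
have h2 := root_free_growth w d0 (fun x => noroot k x kn).
have h3 : normc (Q k).[w] <= e / 2.
  apply: le_trans (H1 _ M1k); apply: (le_trans h2).
  rewrite /rho exprMn mulrA; apply: ler_pM; rewrite ?normc_ge0 ?exprn_ge0 //.
  - by rewrite addr_ge0 // divr_ge0 ?normc_ge0 // ltW.
  - exact: Qz0.
  apply: (@le_trans _ _ ((1 + eta / d) ^+ (size (Q k)).-1)).
    have wd : normc (w - z0) / d <= eta / d.
      by rewrite ler_pM2r ?invr_gt0 // ltW.
    have wd0 : 0 <= normc (w - z0) / d by rewrite divr_ge0 ?normc_ge0 ?(ltW d0).
    by apply: lerXn2r; rewrite ?nnegrE ?lerD2l //; lra.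
  rewrite ler_weXn2l //; first by rewrite lerDl divr_ge0 // ltW.
  by rewrite (leq_trans (leq_pred _)).
have := H2 _ M2k; have := normc_le_dist (psum b (2 ^ k - N0) w) (Q k).[w].
rewrite normcBC; move: h1; rewrite mulrC; lra.
Qed.

(** * Steering a series of signs to zero near 1 *)

(** The tail a + c (z - 1) of the series evolves at z = 1 as a double integrator:
    a loses the chosen sign and c loses the new value of a.  The coordinate
    e = c + a / 2 then decreases by the mean of the old and the new a, and the two
    quadratic bounds leave room for the moves that e makes before a changes
    sign. *)
Definition safe (R : realFieldType) (E a c : R) : Prop :=
  let e := c + a / 2 in
  [/\ -3 <= a <= 3, - E <= e <= E,
      e + a ^+ 2 / 2 - a <= E & - e + a ^+ 2 / 2 + a <= E].

Lemma safeN (R : realFieldType) (E a c : R) : safe E (- a) (- c) -> safe E a c.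
Proof.
rewrite /safe /= => -[/andP[h1 h2] /andP[h3 h4] h5 h6].
by rewrite sqrrN in h5 h6; split; try (apply/andP; split); lra.
Qed.

(** [true] selects the sign -1.  When e >= 0 the rule brings a into [0, 2] and
    keeps it there, which makes e decrease; when e < 0 it does the opposite. *)
Definition feedback (R : realFieldType) (a c : R) : bool :=
  if 0 <= c + a / 2 then a < 1 else a <= -1.

(** Without perturbation the upper bounds on e improve by at least 1/2, and the
    lower bounds are far from being reached. *)
Lemma safe_step_nonneg (R : realFieldType) (E a c p q : R) :
  let s : R := (-1) ^+ (a < 1)%R in
  20 <= E -> safe E a c -> 0 <= c + a / 2 ->
  `|p| <= 1 / 100 -> `|q| <= 1 / 100 ->
  safe E (a - s + p) (c - (a - s) + q).
Proof.
move=> s E20 [/andP[a1 a2] /andP[e1 e2] h1 h2] e0.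
rewrite !ler_norml => /andP[p1 p2] /andP[q1 q2].
have pp : p ^+ 2 <= 1 / 100 by nra.
rewrite /safe /s /=; case: ltP => a01; rewrite ?expr0 ?expr1.
  have pa : -(5/100) <= p * (a + 1) <= 5/100 by apply/andP; split; nra.
  have aa : (a - -1 + p) ^+ 2 = a ^+ 2 + 2 * a + 1 + 2 * (p * (a + 1)) + p ^+ 2 by ring.
  move/andP: pa => [pa1 pa2]; rewrite aa.
  by split; try (apply/andP; split); nra.
have pa : -(5/100) <= p * (a - 1) <= 5/100 by apply/andP; split; nra.
have aa : (a - 1 + p) ^+ 2 = a ^+ 2 - 2 * a + 1 + 2 * (p * (a - 1)) + p ^+ 2 by ring.
move/andP: pa => [pa1 pa2]; rewrite aa.
by split; try (apply/andP; split); nra.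
Qed.

Lemma safe_step (R : realFieldType) (E a c p q : R) :
  let s : R := (-1) ^+ feedback a c in
  20 <= E -> safe E a c -> `|p| <= 1 / 100 -> `|q| <= 1 / 100 ->
  safe E (a - s + p) (c - (a - s) + q).
Proof.
move=> s E20 sac hp hq; rewrite /s /feedback; case: ifPn => e0.
  exact: (safe_step_nonneg E20 sac e0 hp hq).
rewrite -ltNge in e0.
apply: safeN.
have -> : (a <= -1) = ~~ (- a < 1) by rewrite -leNgt lerNr.
have -> : (-1) ^+ (~~ (- a < 1)%R) = - (-1) ^+ (- a < 1)%R :> R.
  by case: (- a < 1); rewrite /= ?expr0 ?expr1 ?opprK.
have := @safe_step_nonneg R E (- a) (- c) (- p) (- q) E20.
rewrite !normrN => /(_ _ _ hp hq) h.
have {h} : safe E (- a - (-1) ^+ (- a < 1)%R - p)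
  (- c - (- a - (-1) ^+ (- a < 1)%R) - q).
  by apply: h; [apply: safeN; rewrite !opprK | rewrite mulNr -opprD oppr_ge0 ltW].
by congr safe; ring.
Qed.

(** The exact dynamics of the coordinates of the tails at z = x + i y, as
    expressed by [next_stateE].  The point 1 is the case of the double
    integrator. *)
Definition next_state (R : realFieldType) (x y : R) (st : R * R) (s : bool) : R * R :=
  let c' := (st.2 - (st.1 - (-1) ^+ s)) / (x ^+ 2 + y ^+ 2) in
  (st.1 - (-1) ^+ s + ((x - 1) ^+ 2 + y ^+ 2) * c', c').

Section Trajectory.
Variables (R : realFieldType) (x y : R) (n : nat) (U : nat -> bool).

Definition choose_sign k (st : R * R) : bool :=
  if (k < n)%N then U k else feedback st.1 st.2.

Fixpoint state k : R * R :=
  if k is j.+1 then next_state x y (state j) (choose_sign j (state j)) else (0, 0).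

Definition ctrl_sign k := choose_sign k (state k).

Lemma stateS k : state k.+1 = next_state x y (state k) (ctrl_sign k).
Proof. by []. Qed.

End Trajectory.

(** The recursion of the tails in coordinates, by the quadratic equation
    (z - 1)^2 = 2 Re (z - 1) (z - 1) - |z - 1|^2. *)
Lemma next_stateE (R : rcfType) (x y : R) st (s : bool) : x ^+ 2 + y ^+ 2 != 0 ->
  let z : R[i] := x +i* y in
  let v (u : R * R) := u.1%:C + u.2%:C * (z - 1) in
  v st = (-1) ^+ s + z * v (next_state x y st s).
Proof.
move=> D0 z v; rewrite /v /next_state /=.
have -> : (-1) ^+ s = ((-1) ^+ s : R)%:C by rewrite rmorph_sign.
move: ((-1) ^+ s) => t; case: st => a c /=.
set c' := (c - (a - t)) / _.
have -> : c = (a - t) + (x ^+ 2 + y ^+ 2) * c'.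
  by rewrite /c' mulrC divfK // addrC subrK.
rewrite /z; apply/eqP; rewrite eq_complex /=.
by apply/andP; split; apply/eqP; ring.
Qed.

(** The k-th partial sum is - z^k times the k-th tail. *)
Lemma vanishes_ctrl (R : realType) (x y K : R) n U :
  let z : R[i] := x +i* y in
  x ^+ 2 + y ^+ 2 != 0 -> normc z < 1 ->
  (forall k, `|(state x y n U k).1| <= K /\ `|(state x y n U k).2| <= K) ->
  vanishes (fun j => (-1) ^+ ctrl_sign x y n U j) z.
Proof.
move=> z D0 z1 hK.
pose v (u : R * R) := u.1%:C + u.2%:C * (z - 1).
have vk k : psum (fun j => (-1) ^+ ctrl_sign x y n U j) k z
            = - (z ^+ k * v (state x y n U k)).
  elim: k => [|k IHk].
    by rewrite /psum big_ord0 /v /= mul0r addr0 mulr0 oppr0.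
  rewrite psumS IHk /v (next_stateE _ (ctrl_sign x y n U k) D0) -/z -stateS exprS.
  by ring.
have K0 : 0 <= K := le_trans (normr_ge0 _) (hK 0%N).1.
apply: (@le_vanishes _ _ (3 * K)) => // k.
rewrite vk normcN normcM normcX mulrC ler_wpM2r ?exprn_ge0 ?normc_ge0 //.
rewrite /v (le_trans (le_normcD _ _)) // normcM !normc_real.
have [h1 h2] := hK k.
have h3 : normc (z - 1) <= 2.
  by rewrite (le_trans (normc_le_B _ _)) // normc1; lra.
have : `|(state x y n U k).2| * normc (z - 1) <= K * 2.
  by apply: ler_pM; rewrite ?normc_ge0.
lra.
Qed.

(** A crude bound: the prefix has a fixed length, and the point z is chosen
    close to 1 depending on it. *)
Lemma prefix_state (R : realFieldType) (x y : R) n U k :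
  1 / 2 <= x ^+ 2 + y ^+ 2 -> (x - 1) ^+ 2 + y ^+ 2 <= 1 ->
  `|(state x y n U k).1| <= 8 ^+ k /\ `|(state x y n U k).2| <= 8 ^+ k.
Proof.
move=> D2 mu1; elim: k => [|k [IH1 IH2]]; first by rewrite /= normr0 expr0; split.
have mu0 : 0 <= (x - 1) ^+ 2 + y ^+ 2 by rewrite addr_ge0 // sqr_ge0.
rewrite stateS /next_state /=; set D := x ^+ 2 + y ^+ 2 in D2 *.
set mu := (x - 1) ^+ 2 + y ^+ 2 in mu0 mu1 *.
set a := (state _ _ _ _ _).1 in IH1 *; set c := (state _ _ _ _ _).2 in IH2 *.
set t := (-1) ^+ _.
have t1 : `|t| = 1 by rewrite /t normr_sign.
have e1 : 1 <= (8 : R) ^+ k by rewrite exprn_ege1 // ler1n.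
have D0 : 0 < D by lra.
have hat : `|a - t| <= 8 ^+ k + 1.
  by rewrite (le_trans (ler_normB _ _)) // t1 lerD2r.
have hc : `|(c - (a - t)) / D| <= 6 * 8 ^+ k.
  rewrite normrM normfV (gtr0_norm D0) ler_pdivrMr //.
  have := ler_normB c (a - t).
  have : 3 * 8 ^+ k <= 6 * 8 ^+ k * D by nra.
  lra.
have hm : `|mu * ((c - (a - t)) / D)| <= 6 * 8 ^+ k.
  rewrite normrM (ger0_norm mu0); apply: le_trans hc.
  by rewrite ler_piMl.
rewrite exprS; split; last by lra.
by have := ler_normD (a - t) (mu * ((c - (a - t)) / D)); lra.
Qed.

Lemma prefix_sum (R : realFieldType) (x y : R) n U k :
  1 / 2 <= x ^+ 2 + y ^+ 2 -> (x - 1) ^+ 2 + y ^+ 2 <= 1 -> (k <= n)%N ->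
  `|(state x y n U k).1 + \sum_(j < k) (-1) ^+ U j|
     <= k%:R * (((x - 1) ^+ 2 + y ^+ 2) * 8 ^+ n).
Proof.
move=> D2 mu1; have mu0 : 0 <= (x - 1) ^+ 2 + y ^+ 2 by rewrite addr_ge0 // sqr_ge0.
elim: k => [|k IHk] kn; first by rewrite big_ord0 /= addr0 normr0 mul0r.
have {IHk} := IHk (ltnW kn).
have := (@prefix_state _ x y n U k.+1 D2 mu1).2.
rewrite big_ord_recr stateS /next_state /= /ctrl_sign /choose_sign kn.
set c' := _ / _; set mu := _ ^+ 2 + _ ^+ 2 in mu0 mu1 *.
set a := (state _ _ _ _ _).1; set S := \sum_(_ < k) _; move: ((-1) ^+ U k) => t hc IH.
clearbody mu.
have -> : a - t + mu * c' + (S + t) = (a + S) + mu * c' by ring.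
apply: (le_trans (ler_normD _ _)); rewrite [k.+1%:R]mulrSr mulrDl mul1r lerD //.
rewrite normrM (ger0_norm mu0) ler_wpM2l // (le_trans hc) //.
by rewrite ler_weXn2l // ler1n.
Qed.

Lemma perturbation_small (R : realFieldType) (E a c t D mu : R) :
  20 <= E -> safe E a c -> `|t| = 1 -> 1 / 2 <= D <= 1 -> 0 <= mu ->
  mu * E <= 1 / 1000 -> (1 - D) * E <= 2 / 1000 ->
  `|mu * ((c - (a - t)) / D)| <= 1 / 100 /\
  `|(c - (a - t)) / D - (c - (a - t))| <= 1 / 100.
Proof.
move=> E20 [/andP[a1 a2] /andP[b1 b2] _ _] t1 /andP[D1 D2] mu0 muE DE.
have D0 : 0 < D by lra.
have /andP[t2 t3] : -1 <= t <= 1 by rewrite -ler_norml t1.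
set c0 := c - (a - t).
have c0E : `|c0| <= 2 * E.
  by rewrite /c0 ler_norml; apply/andP; split; lra.
clearbody c0; clear a1 a2 b1 b2 t1 t2 t3.
have c0D : `|c0 / D| <= 4 * E.
  by rewrite normrM normfV (gtr0_norm D0) ler_pdivrMr //; nra.
split.
  rewrite normrM (ger0_norm mu0).
  have : mu * `|c0 / D| <= mu * (4 * E) by rewrite ler_wpM2l.
  by move: muE; lra.
have -> : c0 / D - c0 = (1 - D) * (c0 / D).
  by rewrite mulrBl mul1r [D * _]mulrC divfK // gt_eqF.
rewrite normrM ger0_norm ?subr_ge0 //.
have : (1 - D) * `|c0 / D| <= (1 - D) * (4 * E) by rewrite ler_wpM2l // subr_ge0.
by move: DE; lra.
Qed.

(** After the prefix, a is near minus the sum of the prescribed signs, and E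
    absorbs the value of c; from then on the feedback rule keeps the state
    safe. *)
Lemma trajectory_safe (R : realFieldType) (x y E : R) n (U : nat -> bool) k :
  let D := x ^+ 2 + y ^+ 2 in let mu := (x - 1) ^+ 2 + y ^+ 2 in
  `|\sum_(j < n) (-1) ^+ U j : R| <= 2 -> 8 ^+ n + 20 <= E ->
  1 / 2 <= D <= 1 -> mu <= 1 ->
  mu * E <= 1 / 1000 -> (1 - D) * E <= 2 / 1000 -> n%:R * (mu * E) <= 1 / 1000 ->
  (n <= k)%N -> safe E (state x y n U k).1 (state x y n U k).2.
Proof.
move=> D mu hU hE D12 mu1 muE DE nmuE nk.
have mu0 : 0 <= mu by rewrite addr_ge0 // sqr_ge0.
have e1 : 0 <= (8 : R) ^+ n by rewrite exprn_ge0.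
have E20 : 20 <= E by lra.
rewrite -(subnKC nk); elim: (k - n)%N => [|i IHi] {k nk}.
  rewrite addn0.
  have D2 : 1 / 2 <= D by case/andP: D12.
  have [h1 h2] := @prefix_state _ x y n U n D2 mu1.
  have h3 := @prefix_sum _ x y n U n D2 mu1 (leqnn _).
  have h4 : n%:R * (mu * 8 ^+ n) <= 1 / 1000.
    by rewrite (le_trans _ nmuE) // ler_wpM2l // ler_wpM2l //; lra.
  rewrite -/mu in h3; move: h2 {h1} h3; set a := (_).1; set c := (_).2.
  move: hU; set S := \sum_(_ < n) _ => hU h2 h3.
  have h5 : `|a| <= 201 / 100.
    by have := ler_normB (a + S) S; rewrite addrK; lra.
  clear h3 h4 hU nmuE DE muE mu1 mu0 D12 D2; clearbody a c.
  move: h5 h2; rewrite !ler_norml => /andP[a1 a2] /andP[b1 b2].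
  have aa : a ^+ 2 <= 9 by nra.
  by rewrite /safe; split; try (apply/andP; split); lra.
have t1 : `|(-1) ^+ ctrl_sign x y n U (n + i) : R| = 1 by rewrite normr_sign.
have [p1 p2] := perturbation_small E20 IHi t1 D12 mu0 muE DE.
rewrite addnS stateS /next_state /= -/D -/mu.
have sE : ctrl_sign x y n U (n + i) =
    feedback (state x y n U (n + i)).1 (state x y n U (n + i)).2.
  by rewrite /ctrl_sign /choose_sign ltnNge leq_addr.
move: p1 p2; rewrite sE; set a := (_).1; set c := (_).2; set t := (-1) ^+ _ => p1 p2.
rewrite -[X in safe E _ X](subrKC (c - (a - t))).
exact: safe_step.
Qed.

(** Eight equal signs would move a by almost 8, more than the width of the
    interval [-3, 3]. *)
Lemma bounded_walk_short_runs (R : realFieldType) (a : nat -> R) (s : nat -> bool)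
    (n k : nat) :
  (forall j, (n <= j)%N -> `|a j| <= 3 /\ `|a j.+1 - (a j - (-1) ^+ s j)| <= 1 / 100) ->
  (n <= k)%N -> exists2 i, (i < 8)%N & s (k + i)%N != s k.
Proof.
move=> ha nk; case: (pickP (fun i : 'I_8 => s (k + i)%N != s k)) => [i si|h].
  by exists i.
have same i : (i < 8)%N -> s (k + i)%N = s k.
  by move=> i8; have := h (Ordinal i8) => /negbFE /eqP.
have drift i : (i <= 8)%N ->
    `|a (k + i)%N - (a k - i%:R * (-1) ^+ s k)| <= i%:R * (1 / 100).
  elim: i => [|i IHi] i8; first by rewrite addn0 !mul0r subr0 subrr normr0.
  have := IHi (ltnW i8); have := (ha _ (leq_trans nk (leq_addr i k))).2.
  rewrite (same i i8) addnS [i.+1%:R]mulrSr !mulrDl !mul1r => h1 h2.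
  rewrite [leRHS]addrC; apply: (le_trans _ (lerD h1 h2)).
  apply: (le_trans _ (ler_normD _ _)); rewrite le_eqVlt; apply/orP; left; apply/eqP.
  by congr `|_|; ring.
have := drift 8%N isT; have := (ha k nk).1; have := (ha _ (leq_trans nk (leq_addr 8 k))).1.
rewrite !ler_norml; case: (s k); rewrite ?expr0 ?expr1 => /andP[? ?] /andP[? ?] /andP[? ?]; lra.
Qed.

Lemma safe_bound (R : realFieldType) (E a c : R) :
  20 <= E -> safe E a c -> `|a| <= E + 2 /\ `|c| <= E + 2.
Proof.
move=> E20 [/andP[a1 a2] /andP[b1 b2] _ _].
by rewrite !ler_norml; split; apply/andP; split; lra.
Qed.

(** Any prescribed prefix with a small sum can be completed to a series of signs
    that vanishes at z, as soon as z is close to 1.  As the coordinates a and c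
    are real, nothing is lost near the real axis. *)
Lemma steering (R : realType) (n : nat) : exists2 eta : R, 0 < eta &
  forall (z : R[i]) (U : nat -> bool), normc z < 1 -> normc (z - 1) < eta ->
  `|\sum_(j < n) (-1) ^+ U j : R| <= 2 ->
  exists s : nat -> bool,
  [/\ forall j, (j < n)%N -> s j = U j,
      vanishes (fun j => (-1) ^+ s j) z &
      forall k, (n <= k)%N -> exists2 i, (i < 8)%N & s (k + i)%N != s k].
Proof.
(* E bounds c after the prefix; eta makes all perturbations small against 1 / E *)
have [E hE] : exists E : R, 8 ^+ n + 20 <= E by exists (8 ^+ n + 20).
have e1 : 1 <= (8 : R) ^+ n by rewrite exprn_ege1 // ler1n.
have E20 : 20 <= E by lra.
have [eta [eta0 etaE etanE]] : exists eta : R,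
    [/\ 0 < eta, eta * E <= 1 / 1000 & n%:R * (eta * E) <= 1 / 1000].
  have m0 : 0 < n.+1%:R :> R by rewrite ltr0n.
  have E0 : 0 < E by lra.
  have [d [d0 ->]] : exists d : R, 0 < d /\ 1 / 1000 = d by exists (1 / 1000); split; lra.
  have Einv : d / (n.+1%:R * E) * E = d / n.+1%:R.
    by rewrite invfM mulrA divfK // gt_eqF.
  exists (d / (n.+1%:R * E)); split.
  - by rewrite divr_gt0 // mulr_gt0.
  - by rewrite Einv ler_pdivrMr // ler_peMr ?ler1n // ltW.
  - by rewrite Einv mulrCA ler_piMr ?(ltW d0) // ler_pdivrMr // mul1r ler_nat.
exists eta => // z U z1 zeta hU.
have eta1 : eta <= 1 / 1000 by apply: le_trans etaE; rewrite ler_peMr ?(ltW eta0) //; lra.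
case: z z1 zeta => x y z1 zeta.
pose D := x ^+ 2 + y ^+ 2; pose mu := (x - 1) ^+ 2 + y ^+ 2.
have mu0 : 0 <= mu by rewrite addr_ge0 // sqr_ge0.
have mu_le : mu <= eta.
  have <- : normc ((x +i* y) - 1) ^+ 2 = mu.
    by rewrite /= sqr_sqrtr ?addr_ge0 ?sqr_ge0 // subr0.
  rewrite expr2 (le_trans (ler_pM _ _ (ltW zeta) (ltW zeta))) ?normc_ge0 //.
  by rewrite ler_piMl ?(ltW eta0) //; lra.
have D_norm : normc (x +i* y) ^+ 2 = D.
  by rewrite /= sqr_sqrtr ?addr_ge0 ?sqr_ge0.
have nz_ge : 1 - eta <= normc (x +i* y).
  by have := normc_le_dist 1 (x +i* y); rewrite normc1 normcBC; lra.
have D_ge : 1 - 2 * eta <= D.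
  rewrite -D_norm; move: nz_ge eta0 eta1; move: (normc _) => r; clear; nra.
have D_le1 : D <= 1.
  by rewrite -D_norm exprn_ile1 ?normc_ge0 // ltW.
have D12 : 1 / 2 <= D <= 1 by lra.
have D0 : D != 0 by rewrite gt_eqF //; lra.
have muE : mu * E <= 1 / 1000 by apply: le_trans etaE; rewrite ler_wpM2r //; lra.
have DE : (1 - D) * E <= 2 / 1000.
  have : (1 - D) * E <= 2 * eta * E by rewrite ler_wpM2r //; lra.
  by move: etaE; clear; lra.
have nmuE : n%:R * (mu * E) <= 1 / 1000.
  apply: le_trans etanE; rewrite ler_wpM2l // ler_wpM2r //; lra.
have mu1 : mu <= 1 by move: mu_le eta1; clear; lra.
have Sk k : (n <= k)%N -> safe E (state x y n U k).1 (state x y n U k).2.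
  exact: trajectory_safe.
exists (ctrl_sign x y n U); split.
- by move=> j jn; rewrite /ctrl_sign /choose_sign jn.
- apply: (@vanishes_ctrl _ x y (E + 2)) => // k.
  have [/Sk/(safe_bound E20) //|kn] := leqP n k.
  have [h1 h2] : `|(state x y n U k).1| <= 8 ^+ k /\ `|(state x y n U k).2| <= 8 ^+ k.
    by apply: prefix_state => //; case/andP: D12.
  have h3 : (8 : R) ^+ k <= E + 2.
    rewrite (@le_trans _ _ (8 ^+ n)) ?ler_weXn2l ?ler1n // 1?ltnW //.
    by rewrite (le_trans _ (le_trans hE _)) // lerDl.
  by split; [apply: le_trans h1 _ | apply: le_trans h2 _].
- move=> k; apply: (@bounded_walk_short_runs _ (fun j => (state x y n U j).1)) => j nj.
  have sj := Sk _ nj; split.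
    by case: sj => h _ _ _; rewrite ler_norml.
  have t1 : `|(-1) ^+ ctrl_sign x y n U j : R| = 1 by rewrite normr_sign.
  have [p1 _] := perturbation_small E20 sj t1 D12 mu0 muE DE.
  by rewrite stateS /next_state /= addrC addKr.
Qed.

(** * Powers close to 1 *)

Lemma normc_le_ReIm (R : rcfType) (z : R[i]) : normc z <= `|complex.Re z| + `|complex.Im z|.
Proof.
rewrite [z in leLHS]complexE (le_trans (le_normcD _ _)) // normcM !normc_real.
by rewrite /= expr0n add0r expr1n sqrtr1 mul1r.
Qed.

Lemma Re_Im_le1 (R : rcfType) (z : R[i]) : normc z <= 1 ->
  -1 <= complex.Re z <= 1 /\ -1 <= complex.Im z <= 1.
Proof.
case: z => x y h.
have h1 : x ^+ 2 + y ^+ 2 <= 1.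
  have : normc (x +i* y) ^+ 2 <= 1 by rewrite exprn_ile1 ?normc_ge0.
  by rewrite /= sqr_sqrtr ?addr_ge0 ?sqr_ge0.
by split; apply/andP; split => /=; nra.
Qed.

(** The induction step of the Bernoulli inequality (1 - h)^i >= 1 - i h. *)
Lemma bernoulli_step (R : realFieldType) (r p c h : R) :
  1 - h < r -> 1 - c <= p -> 0 <= h -> 0 <= p <= 1 -> 1 - (c + h) <= r * p.
Proof. by move=> rh pc h0 /andP[p0 p1]; nra. Qed.

(** Among the first M + 1 powers of w two fall in the same cell of a grid; their
    quotient is close to 1 because w^i stays away from 0 for i <= M. *)
Lemma dirichlet_power (R : realType) (eta : R) : 0 < eta ->
  exists M : nat, exists2 rho : R, 0 < rho < 1 &
  forall w : R[i], rho < normc w < 1 ->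
    exists2 m, (0 < m <= M)%N & normc (w ^+ m - 1) < eta.
Proof.
move=> eta0.
pose K := (Num.bound (4 / eta)).+1.
have K0 : 0 < K%:R :> R by rewrite ltr0n.
have hK : 4 / K%:R < eta.
  rewrite ltr_pdivrMr // mulrC -ltr_pdivrMr //.
  have := @archi_boundP R (4 / eta); rewrite divr_ge0 ?(ltW eta0) // => /(_ isT) h.
  by rewrite (lt_le_trans h) // ler_nat leqnSn.
pose M := (K.*2.+1 * K.*2.+1)%N.
have M0 : 0 < M%:R :> R by rewrite ltr0n.
exists M; exists (1 - (2 * M%:R)^-1).
  have : 2 <= 2 * M%:R :> R by rewrite ler_peMr // ler1n.
  move=> h; have : (2 * M%:R)^-1 <= 2^-1 :> R by rewrite lef_pV2 ?posrE // (lt_le_trans _ h).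
  have : 0 < (2 * M%:R)^-1 :> R by rewrite invr_gt0 (lt_le_trans _ h).
  lra.
move=> w /andP[w0 w1].
have wi_le i : normc (w ^+ i) <= 1 by rewrite normcX exprn_ile1 ?normc_ge0 // ltW.
have wi_ge i : (i <= M)%N -> 1 / 2 <= normc (w ^+ i).
  move=> iM; apply: (@le_trans _ _ (1 - i%:R * (2 * M%:R)^-1)).
    have : i%:R * (2 * M%:R)^-1 <= 1 / 2 :> R.
      by rewrite invfM mulrCA div1r ler_piMr // ler_pdivrMr // mul1r ler_nat.
    by lra.
  elim: i {iM} => [|i IHi]; first by rewrite mul0r subr0 expr0 normc1.
  rewrite exprS normcM [i.+1%:R]mulrSr mulrDl mul1r.
  have h0 : 0 <= (2 * M%:R)^-1 :> R by rewrite invr_ge0 mulr_ge0 // ltW.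
  have h1 := wi_le i; have h2 := normc_ge0 (w ^+ i).
  by apply: bernoulli_step => //; rewrite h2 h1.
pose cell (x : R) : nat := Num.truncn ((x + 1) * K%:R).
have cellP x : -1 <= x <= 1 -> (cell x < K.*2.+1)%N /\
    (cell x)%:R <= (x + 1) * K%:R < (cell x).+1%:R.
  move=> /andP[x0 x1]; have h0 : 0 <= (x + 1) * K%:R by rewrite mulr_ge0 ?(ltW K0) //; lra.
  have h := truncn_itv h0; split => //.
  rewrite ltnS -(ler_nat R) -muln2 natrM; case/andP: h => h _; apply: (le_trans h).
  by rewrite mulrC ler_wpM2l ?(ltW K0) //; lra.
pose f (i : 'I_M.+1) : 'I_K.*2.+1 * 'I_K.*2.+1 :=
  (inord (cell (complex.Re (w ^+ i))), inord (cell (complex.Im (w ^+ i)))).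
have : ~~ injectiveb f.
  apply/negP => /injectiveP/leq_card; rewrite card_prod !card_ord.
  by rewrite ltnn.
move=> /injectivePn[i [j ij fij]].
wlog lt_ij : i j ij fij / (i < j)%N.
  move=> hw; have /orP[h|h] : (i < j)%N || (j < i)%N by rewrite -neq_ltn.
    exact: (hw i j).
  by apply: (hw j i) => //; rewrite eq_sym.
case: fij => e1 e2.
have [/cellP[c1 d1] /cellP[c2 d2]] := Re_Im_le1 (wi_le i).
have [/cellP[c3 d3] /cellP[c4 d4]] := Re_Im_le1 (wi_le j).
have {e1}E1 : cell (complex.Re (w ^+ i)) = cell (complex.Re (w ^+ j)).
  by move/(congr1 val): e1; rewrite /= !inordK.
have {e2}E2 : cell (complex.Im (w ^+ i)) = cell (complex.Im (w ^+ j)).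
  by move/(congr1 val): e2; rewrite /= !inordK.
have close (x y : R) : cell x = cell y ->
    (cell x)%:R <= (x + 1) * K%:R < (cell x).+1%:R ->
    (cell y)%:R <= (y + 1) * K%:R < (cell y).+1%:R -> `|x - y| <= K%:R^-1.
  move=> -> /andP[p1 p2] /andP[q1 q2].
  have : `|(x - y) * K%:R| <= 1.
    move: p1 p2 q1 q2; rewrite -addn1 natrD mulrBl !mulrDl ler_norml => *.
    by apply/andP; split; lra.
  by rewrite normrM (gtr0_norm K0) -ler_pdivlMr // div1r.
have wij : normc (w ^+ i - w ^+ j) <= 2 / K%:R.
  rewrite (le_trans (normc_le_ReIm _)) // !raddfB /= mulrDl mul1r lerD //; exact: close.
exists (j - i)%N.
  rewrite subn_gt0 lt_ij /= (leq_trans (leq_subr _ _)) //.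
  by rewrite -ltnS ltn_ord.
have h1 := wi_ge i; rewrite -ltnS ltn_ord in h1; have {}h1 := h1 isT.
rewrite normcBC; apply: le_lt_trans hK.
have : normc (w ^+ i) * normc (1 - w ^+ (j - i)) <= 2 / K%:R.
  by rewrite -normcM mulrBr mulr1 -exprD subnKC // ltnW.
have -> : 4 / K%:R = 2 * (2 / K%:R) :> R by lra.
have h2 : 1 / 2 * normc (1 - w ^+ (j - i)) <=
          normc (w ^+ i) * normc (1 - w ^+ (j - i)) by rewrite ler_wpM2r ?normc_ge0.
by move=> h3; have := le_trans h2 h3; lra.
Qed.

(** * Series of signs with short runs and a prescribed zero *)

Definition sign_series (R : rcfType) (s : nat -> bool) (j : nat) : R[i] := (-1) ^+ s j.
Arguments sign_series : clear implicits.

Lemma normc_sign (R : rcfType) (b : bool) : normc ((-1) ^+ b : R[i]) = 1.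
Proof. by rewrite normcX normcN normc1 expr1n. Qed.

(** The residue class of 0 modulo m carries [s0], all others carry [s1]. *)
Definition interleave (m : nat) (s0 s1 : nat -> bool) (k : nat) : bool :=
  if (k %% m == 0)%N then s0 (k %/ m)%N else s1 (k %/ m)%N.

(** Grouping the exponents by residue modulo m + 1 gives a combination of the
    two series at w^(m+1). *)
Lemma psum_interleave (R : rcfType) m s0 s1 q (w : R[i]) :
  psum (sign_series R (interleave m.+1 s0 s1)) (q * m.+1) w =
  psum (sign_series R s0) q (w ^+ m.+1) +
  (\sum_(i < m) w ^+ i.+1) * psum (sign_series R s1) q (w ^+ m.+1).
Proof.
elim: q => [|q IHq]; first by rewrite mul0n /psum !big_ord0 mulr0 addr0.
rewrite mulSnr {1}/psum big_split_ord /= -/(psum _ _ _) IHq.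
rewrite !psumS big_ord_recl /= addn0 mulrDr addrACA; congr (_ + (_ + _)).
  rewrite /sign_series /interleave modnMl eqxx mulnK //.
  by rewrite -exprM mulnC.
rewrite mulr_suml; apply: eq_bigr => i _; rewrite /bump /= add1n.
rewrite /sign_series /interleave modnMDl divnMDl // modn_small ?divn_small ?ltnS //.
by rewrite addn0 -exprM mulnC exprD /=; ring.
Qed.

Lemma vanishes_interleave (R : realType) m s0 s1 (w : R[i]) : normc w < 1 ->
  vanishes (sign_series R s0) (w ^+ m.+1) ->
  vanishes (sign_series R s1) (w ^+ m.+1) ->
  vanishes (sign_series R (interleave m.+1 s0 s1)) w.
Proof.
move=> w1 v0 v1.
apply: (@le_vanishes _ _ (1 / (1 - normc w))) => //.
apply: vanishes_cofinal => // [j|e n e0]; first by rewrite normc_sign.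
pose S := \sum_(i < m) w ^+ i.+1.
have S0 : 0 < normc S + 1 by rewrite ltr_wpDl ?normc_ge0.
have e2 : 0 < e / 2 by lra.
have [N0 H0] := v0 _ e2.
have [N1 H1] := v1 _ (divr_gt0 e2 S0).
exists (maxn n (maxn N0 N1) * m.+1)%N.
  by rewrite (leq_trans (leq_maxl n (maxn N0 N1))) // leq_pmulr.
set q := maxn _ _.
have q0 : (N0 <= q)%N by rewrite leq_max leq_maxl orbT.
have q1 : (N1 <= q)%N by rewrite leq_max leq_maxr orbT.
rewrite psum_interleave (le_trans (le_normcD _ _)) // normcM.
have := H0 q q0; have := H1 q q1; rewrite !add0r => h1 h0.
have : normc S * normc (psum (sign_series R s1) q (w ^+ m.+1)) <= e / 2.
  apply: (le_trans (ler_wpM2l (normc_ge0 _) h1)).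
  by rewrite mulrA ler_pdivrMr // mulrC mulrDr mulr1 lerDl ltW.
by move=> h2; have := lerD h0 h2; rewrite /S; lra.
Qed.

Definition short_runs (L : nat) (s : nat -> bool) (k0 : nat) : Prop :=
  forall k, (k0 <= k)%N -> exists2 i, (i < L)%N & s (k + i)%N != s k.

(** A window of L (m + 1) consecutive positions contains L consecutive multiples
    of m + 1, on which the word is [s0]. *)
Lemma short_runs_interleave m L s0 s1 k0 :
  short_runs L s0 k0 -> short_runs (L * m.+1) (interleave m.+1 s0 s1) (k0 * m.+1).
Proof.
move=> h k hk.
pose q := ((k + m) %/ m.+1)%N.
have q1 : (k <= q * m.+1)%N.
  have := divn_eq (k + m) m.+1; have := ltn_pmod (k + m) (ltn0Sn m); rewrite -/q; lia.
have q2 : (q * m.+1 <= k + m)%N by exact: leq_trunc_div.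
have kq : (k0 <= q)%N by rewrite -(leq_pmul2r (ltn0Sn m)) (leq_trans hk).
have [i iL hi] := h q kq.
have e1 : interleave m.+1 s0 s1 (q * m.+1) = s0 q by rewrite /interleave modnMl eqxx mulnK.
have e2 : interleave m.+1 s0 s1 ((q + i) * m.+1) = s0 (q + i)%N.
  by rewrite /interleave modnMl eqxx mulnK.
have [e3|e3] := eqVneq (interleave m.+1 s0 s1 (q * m.+1)) (interleave m.+1 s0 s1 k).
  exists ((q + i) * m.+1 - k)%N; first by nia.
  by rewrite subnKC; [rewrite -e3 e1 e2 | nia].
by exists (q * m.+1 - k)%N; [nia | rewrite subnKC].
Qed.

(** A run of 40 minus signs, the first of which may be replaced by a plus sign,
    and then 40 times the pattern plus, plus, minus, which brings the sum back
    to 0 with short runs.  Interleaved, these words produce a run of minus signs after a single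
    plus sign. *)
Definition prefix_word (first : bool) (k : nat) : bool :=
  if (k < 40)%N then (first || (0 < k)%N) else ((k - 40) %% 3 == 2)%N.

Lemma sum_prefix_word (R : realFieldType) first :
  `|\sum_(j < 160) (-1) ^+ prefix_word first j : R| <= 2.
Proof.
pose add (b : bool) k (s : int) := (if prefix_word b k then -1 else 1) + s.
have -> : \sum_(j < 160) (-1) ^+ prefix_word first j =
    (foldr (add first) 0 (iota 0 160))%:~R :> R.
  rewrite -(big_mkord xpredT (fun j => (-1) ^+ prefix_word first j)) /index_iota subn0.
  elim: (iota _ _) => [|k s IHs]; first by rewrite big_nil.
  by rewrite big_cons IHs /= rmorphD /=; case: (prefix_word _ _).
have -> : foldr (add first) 0 (iota 0 160) = if first then 0 else 2.
  by case: first; vm_compute.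
by case: first; rewrite ?normr0 ?ger0_norm.
Qed.

Lemma short_runs_prefix first s : (forall j, (j < 160)%N -> s j = prefix_word first j) ->
  short_runs 8 s 160 -> short_runs 10 s 40.
Proof.
move=> hs ht k k40.
have [k160|k160] := leqP 160 k.
  by have [i i8 si] := ht k k160; exists i => //; rewrite (leq_trans i8).
(* a window from 158 or 159 contains the eight signs from 160 on *)
have [k158|k158] := leqP 158 k.
  have [i i8 si] := ht 160%N (leqnn _).
  have [e|e] := eqVneq (s 160%N) (s k).
    by exists (160 + i - k)%N; [lia | rewrite subnKC ?e //; [rewrite -e | lia]].
  by exists (160 - k)%N; [lia | rewrite subnKC //; lia].
have sk i : (i < 3)%N -> s (k + i)%N = ((k + i - 40) %% 3 == 2)%N.
  move=> i3; rewrite hs; last by lia.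
  by rewrite /prefix_word ifN // -leqNgt (leq_trans k40) // leq_addr.
have [E1|E1] := eqVneq (s (k + 1)%N) (s k); last by exists 1%N.
exists 2%N => //; apply/eqP => E2; move: E1 E2.
have := sk 0%N isT; rewrite addn0 => ->; rewrite !sk //.
have : (k - 40 + 1 = k + 1 - 40)%N by lia.
have : (k - 40 + 2 = k + 2 - 40)%N by lia.
move=> <- <-; move: (k - 40)%N => n.
case: (n %% 3)%N (ltn_pmod n (isT : 0 < 3)%N) (modnDml n 1 3) (modnDml n 2 3)
  => [|[|[|//]]] _ <- <- //.
Qed.

Lemma interleave_prefix m s0 s1 :
  (forall j, (j < 160)%N -> s0 j = prefix_word false j) ->
  (forall j, (j < 160)%N -> s1 j = prefix_word true j) ->
  forall k, (0 < k <= (40 * m.+1).-1)%N -> interleave m.+1 s0 s1 k = true.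
Proof.
move=> h0 h1 k /andP[k0 kN].
have q40 : (k %/ m.+1 < 40)%N by rewrite ltn_divLR //; lia.
rewrite /interleave; case: eqP => [km|_].
  rewrite h0 /prefix_word ?q40 /=; last by lia.
  by have := divn_eq k m.+1; rewrite km addn0; case: (k %/ m.+1)%N => //; lia.
by rewrite h1 /prefix_word ?q40 //; lia.
Qed.

(** The two kinds of words required for |z| > 1 (with the initial run) and for
    |z| < 1 (with short runs only), at a point of the unit disc close enough to
    the unit circle. *)
Lemma sign_series_zeros (R : realType) : exists2 rho : R, 0 < rho < 1 &
  forall w : R[i], rho < normc w < 1 -> exists N L : nat,
  [/\ (3 * L.+1 <= N)%N, (0 < L)%N,
   exists a, [/\ a 0%N = false, (forall k, (0 < k <= N)%N -> a k = true),
                short_runs L a N.+1 & vanishes (sign_series R a) w] &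
   exists b, short_runs L b 0 /\ vanishes (sign_series R b) w].
Proof.
have [eta1 e10 H1] := @steering R 160.
have [eta2 e20 H2] := @steering R 0.
have e120 : 0 < Num.min eta1 eta2 by rewrite lt_min e10.
have [M [rho hrho HM]] := dirichlet_power e120.
exists rho => // w /andP[w0 w1].
have [[|m] // /andP[_ mM]] := HM w (introT andP (conj w0 w1)).
rewrite lt_min => /andP[we1 we2].
have wm1 : normc (w ^+ m.+1) < 1 by rewrite normcX exprn_ilt1 ?normc_ge0.
(* the plus sign at 0 shortens the first run by one *)
exists (40 * m.+1).-1, (10 * m.+1)%N; split; [by clear; lia|by clear; lia| |].
  have [s0 [s0U v0 t0]] := H1 _ (prefix_word false) wm1 we1 (sum_prefix_word _ _).
  have [s1 [s1U v1 t1]] := H1 _ (prefix_word true) wm1 we1 (sum_prefix_word _ _).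
  exists (interleave m.+1 s0 s1); split.
  - by rewrite /interleave mod0n eqxx div0n s0U.
  - exact: interleave_prefix.
  - rewrite prednK ?muln_gt0 //.
    by apply: short_runs_interleave; apply: (short_runs_prefix s0U).
  - exact: vanishes_interleave.
have h0 : `|\sum_(j < 0) (-1) ^+ (fun _ : nat => false) j : R| <= 2.
  by rewrite big_ord0 normr0.
have [s [_ v t]] := H2 _ (fun _ => false) wm1 we2 h0.
exists (interleave m.+1 s s); split; last exact: vanishes_interleave.
rewrite -[0%N](mul0n m.+1); apply: short_runs_interleave => k hk.
by have [i i8 si] := t k hk; exists i => //; rewrite (leq_trans i8).
Qed.

(** * Dominant words and tent maps *)

(** The initial run, from 1 to N, is at least three times as long as any run
    that starts later; this is what makes the word admissible. *)
Definition dominant (a : nat -> bool) (p N L : nat) : Prop :=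
  [/\ a 0%N = false, (forall k, (0 < k <= N)%N -> a k = true),
      (N < p)%N, (3 * L <= N)%N /\ (1 < L)%N &
      forall k, (N < k)%N -> (k + L <= p)%N ->
        exists2 i, (i < L)%N & a (k + i)%N != a k].

(** The k-th symbol of the itinerary: [true] when the k-th point of the orbit is
    on the left of the turning point.  The word itself records the sign of the
    slope of the iterates along the orbit. *)
Definition flip (a : nat -> bool) (k : nat) : bool := a k (+) a k.-1.

Lemma flip_run_end a p N L k : dominant a p N L -> (N.+1 < k <= p)%N ->
  exists2 r, (r < L)%N & (k + r <= p)%N && ((k + r == p)%N || flip a (k + r)%N).
Proof.
move=> [_ _ _ _ turn] /andP[Nk kp].
have [kL|kL] := leqP (k.-1 + L) p; last first.
  by exists (p - k)%N; [nlia | rewrite subnKC // leqnn eqxx].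
have [i iL hi] := turn k.-1 (ltac:(nlia)) kL.
have ex : exists j, (0 < j <= i)%N && flip a (k.-1 + j).
  apply: contrapT => nex; move/negP: hi; apply; apply/eqP.
  have h j : (j <= i)%N -> a (k.-1 + j)%N = a k.-1.
    elim: j => [|j IHj] ji; first by rewrite addn0.
    rewrite -(IHj (ltnW ji)); case: (eqVneq (a (k.-1 + j.+1)%N) (a (k.-1 + j)%N)) => // ne.
    exfalso; apply: nex; exists j.+1; rewrite ltnS leq0n ji /= /flip addnS /=.
    by move: ne; rewrite addnS; case: (a _) (a _) => [] [].
  exact: h.
have [j /andP[/andP[j0 ji] fj]] := ex.
by exists j.-1; [nlia | rewrite (_ : (k + j.-1)%N = (k.-1 + j)%N) ?fj ?orbT; nlia].
Qed.

Lemma flip_prefix a p N L k : dominant a p N L -> (1 < k <= N)%N -> flip a k = false.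
Proof. by move=> [_ h _ _ _] kN; rewrite /flip !h //; nlia. Qed.

Lemma flip1 a p N L : dominant a p N L -> (0 < N)%N -> flip a 1 = true.
Proof. by move=> [h0 h _ _ _] N0; rewrite /flip h ?h0 //; nlia. Qed.

(** Along a run the distance X to the fixed point shrinks at most by the factor
    q at each step backwards, and X >= 1 where a run ends.  So short runs stay
    away from the fixed point. *)
Lemma deficit_ladder (R : realFieldType) (e : nat -> bool) (X : nat -> R) (q : R)
    p r k :
  0 < q <= 1 -> 1 <= X p ->
  (forall k, (0 < k < p)%N -> e k -> 1 <= X k) ->
  (forall k, (0 < k < p)%N -> e k = false -> q * X k.+1 <= X k) ->
  (0 < k)%N -> (k + r <= p)%N && ((k + r == p)%N || e (k + r)%N) -> q ^+ r <= X k.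
Proof.
move=> /andP[q0 q1] Xp Xe Xn; elim: r k => [|r IHr] k k0 /andP[krp he].
  rewrite expr0; rewrite addn0 in he krp.
  by case/orP: he => [/eqP ->//|ek]; have [->//|kp] := eqVneq k p; apply: Xe => //; nlia.
have kp : (0 < k < p)%N by nlia.
case ek: (e k).
  by apply: le_trans (Xe k kp ek); rewrite exprn_ile1 // ltW.
apply: le_trans (Xn k kp ek); rewrite exprS ler_pM2l //; apply: IHr => //.
by rewrite addSnnS krp.
Qed.

(** The orbit is computed backwards from its last point by inverse branches [g]
    prescribed by the itinerary; the j-th step is the point of index p - j. *)
Fixpoint back_orbit (S : Type) (x0 : S) (g : bool -> S -> S) (e : nat -> bool)
    (p j : nat) : S :=
  if j is i.+1 then g (e (p - j)%N) (back_orbit x0 g e p i) else x0.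

Lemma back_orbitS (S : Type) (x0 : S) g (e : nat -> bool) p k : (0 < k < p)%N ->
  back_orbit x0 g e p (p - k) = g (e k) (back_orbit x0 g e p (p - k.+1)).
Proof.
by move=> /andP[k0 kp]; rewrite -[in LHS](subnSK kp) /= subnSK // subKn // ltnW.
Qed.

Definition tent_step (R : nzRingType) (t : R) (b : bool) (v : R) : R :=
  (-1) ^+ b * (1 + t * v).

Section Tent.
Variables (R : realType) (a : nat -> bool) (p N L : nat).
Hypothesis dom : dominant a p N L.

Let sp := @sign_poly R a p.

Lemma sign_poly_neg : sp.[3/5] <= 0.
Proof.
have [a0 aN Np [NL L1] _] := dom.
rewrite (horner_coef_wide _ (n := p)); last by rewrite size_sign_poly.
have [p' pE] : exists p', p = (N.+1 + p')%N by exists (p - N.+1)%N; nlia.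
rewrite pE big_split_ord /= big_ord_recl /= coef_sign_poly expr0 mulr1 ifT; last by nlia.
rewrite a0 expr0.
have -> : \sum_(i < N) sp`_(bump 0 i) * (3 / 5) ^+ bump 0 i
        = - \sum_(i < N) (3 / 5) ^+ i.+1.
  rewrite -sumrN; apply: eq_bigr => i _; rewrite /bump /= add1n coef_sign_poly ifT; last first.
    by have := ltn_ord i; nlia.
  by rewrite aN ?expr1 ?mulN1r //; have := ltn_ord i; nlia.
have tail : \sum_(i < p') sp`_(N.+1 + i) * (3 / 5) ^+ (N.+1 + i)
   <= \sum_(i < p') (3 / 5) ^+ (N.+1 + i).
  apply: ler_sum => i _; apply: ler_piMl; first by rewrite exprn_ge0 //; lra.
  by rewrite coef_sign_poly; case: ifP => // _; rewrite (le_trans (ler_norm _)) // normr_sign.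
have geo n m : \sum_(i < n) (3 / 5) ^+ (m + i) = 5/2 * (3/5) ^+ m * (1 - (3 / 5) ^+ n) :> R.
  elim: n => [|n IHn]; first by rewrite big_ord0 expr0 subrr mulr0.
  by rewrite big_ord_recr /= IHn exprD exprS; lra.
rewrite geo in tail.
have -> : \sum_(i < N) (3 / 5) ^+ i.+1 = 3 / 2 * (1 - (3 / 5) ^+ N) :> R.
  by have := geo N 1%N; rewrite expr1 => ->; lra.
have h0 : 0 <= (3 / 5) ^+ p' :> R by rewrite exprn_ge0 //; lra.
have h1 : 0 <= (3 / 5) ^+ N.+1 :> R by rewrite exprn_ge0 //; lra.
have h2 : (3 / 5) ^+ N <= 1 / 6 :> R.
  have : (3 / 5) ^+ N <= (3 / 5) ^+ 4 :> R.
    by apply: ler_wiXn2l; [lra|lra|nlia].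
  by rewrite !exprS expr0; lra.
have h3 : 0 <= (3 / 5) ^+ N.+1 * (3 / 5) ^+ p' :> R by rewrite mulr_ge0.
have h4 : (3 / 5) ^+ N.+1 = 3 / 5 * (3 / 5) ^+ N :> R by rewrite exprS.
move: tail h0 h1 h2 h3 h4; move: (\sum_(i < p') _) => S; lra.
Qed.

(** The long initial run makes P(3/5) negative, while P(0) = 1. *)
Lemma tent_parameter : exists2 t : R, 0 < t <= 3 / 5 & root sp t.
Proof.
have [a0 aN Np [NL L1] _] := dom.
have sp0 : sp.[0] = 1.
  by rewrite horner_coef0 coef_sign_poly a0 ifT //; nlia.
have [||t /andP[t0 t1] rt] := @poly_ivt R (- sp) 0 (3 / 5); first by lra.
  by rewrite !hornerN sp0 oppr_le0 ler01 oppr_ge0 sign_poly_neg.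
rewrite rootN in rt; exists t => //; rewrite t1 andbT lt_neqAle t0 andbT.
by apply: contraTneq rt => <-; rewrite rootE sp0 oner_eq0.
Qed.

(** The values u_k = e_k (1 + t u_(k+1)), where e_k is the k-th symbol, are the
    backward orbit of the turning point 0 under v |-> (|v| - 1) / t, provided
    that 1 + t u_k >= 0.  The equation P(t) = 0 says that the orbit starts at
    the critical value -1/t, and dominance says that no later point is below
    it. *)
Lemma tent_orbit : exists t : R, exists u : nat -> R,
  [/\ 0 < t < 1, root sp t, 1 + t * u 1%N = 0, u p = 0 &
    (forall k, (0 < k < p)%N -> u k = (-1) ^+ flip a k * (1 + t * u k.+1)) /\
    (forall k, (1 < k <= p)%N -> 0 < 1 + t * u k)].
Proof.
have [a0 aN Np [NL L1] _] := dom.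
have N0 : (0 < N)%N by nlia.
have p1 : (0 < 1 < p)%N by nlia.
have [t /andP[t0 t1] rt] := tent_parameter.
pose ur := back_orbit 0 (tent_step t) (flip a) p.
pose u k := ur (p - k)%N.
have up : u p = 0 by rewrite /u subnn.
have uS k : (0 < k < p)%N -> u k = (-1) ^+ flip a k * (1 + t * u k.+1).
  exact: back_orbitS.
(* W is the fixed point of v |-> 1 + t v *)
pose W := (1 - t)^-1.
have WE : 1 + t * W = W by rewrite /W; field; rewrite subr_eq0 gt_eqF //; lra.
have W2 : W <= 5 / 2 by nra.
have W1 : 1 <= W by nra.
have ubound k : (0 < k <= p)%N -> `|u k| <= W.
  move=> kp; have -> : k = (p - (p - k))%N by nlia.
  have : (p - k < p)%N by nlia.
  elim: (p - k)%N => [_|j IHj jp]; first by rewrite subn0 up normr0; lra.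
  rewrite uS; last by nlia.
  rewrite normrM normr_sign mul1r (le_trans (ler_normD _ _)) // normr1 -[leRHS]WE lerD2l.
  by rewrite normrM (gtr0_norm t0) ler_pM2l // subnSK ?IHj //; nlia.
have u1E : 1 + t * u 1%N = 0.
  have := rootP rt; rewrite (horner_coef_wide _ (n := p)); last by rewrite size_sign_poly.
  move=> <-; have h j : (j < p)%N -> 1 + t * u 1%N =
      \sum_(i < j) sp`_i * t ^+ i + (-1) ^+ a j * t ^+ j * (1 + t * u j.+1).
    elim: j => [_|j IHj jp]; first by rewrite big_ord0 add0r a0 expr0 !mul1r.
    rewrite (IHj (ltnW jp)) big_ord_recr /= -addrA; congr (_ + _).
    rewrite coef_sign_poly (ltnW jp) (uS j.+1) // /flip /= exprS signr_addb.
    have -> : (-1) ^+ a j.+1 * (t * t ^+ j) * (1 + t * u j.+2) =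
      ((-1) ^+ a j * (-1) ^+ a j) * (-1) ^+ a j.+1 * (t * t ^+ j) * (1 + t * u j.+2).
      by rewrite -expr2 sqrr_sign mul1r.
    ring.
  rewrite (h p.-1); last by nlia.
  rewrite prednK ?up; last by nlia.
  rewrite mulr0 addr0 mulr1 -[in RHS](prednK (n := p)); last by nlia.
  by rewrite big_ord_recr /= coef_sign_poly ifT //; nlia.
exists t, u; split => //; first by lra.
split => // k /andP[k1 kp].
have [->|kp'] := eqVneq k p; first by rewrite up mulr0 addr0.
have kp2 : (0 < k < p)%N by nlia.
(* distance to the fixed point; it is at least 1 at points on the left of 0 *)
pose X j := W - u j.
have ladder j : (N.+1 < j <= p)%N -> t ^+ L.-1 <= X j.
  move=> hj; have [r rL hr] := flip_run_end dom hj.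
  apply: (@le_trans _ _ (t ^+ r)).
    by apply: ler_wiXn2l; [lra|lra|nlia].
  apply: (@deficit_ladder _ (flip a) X t p) => //; last by nlia.
  - by rewrite t0; lra.
  - by rewrite /X up subr0.
  - move=> i hi fi; rewrite /X (uS i) // fi expr1.
    have := ubound i.+1 (ltac:(nlia)); rewrite ler_norml => /andP[b1 b2].
    have : - (t * W) <= t * u i.+1 by rewrite -mulrN ler_pM2l.
    lra.
  - move=> i hi fi; rewrite /X (uS i) // fi expr0; lra.
case fk: (flip a k); last first.
  rewrite uS // fk expr0 mul1r.
  have := ubound k.+1 (ltac:(nlia)); rewrite ler_norml => /andP[b1 b2].
  have : - (t * W) <= t * u k.+1 by rewrite -mulrN ler_pM2l.
  nra.
have Nk : (N < k)%N.
  by rewrite ltnNge; apply/negP => kN; move: fk; rewrite (flip_prefix dom) //; nlia.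
have Xk := ladder k.+1 (ltac:(nlia)).
have X2 : X 2%N <= t ^+ N.-1 * (2 * W).
  have h j : (j < N)%N -> X 2%N = t ^+ j * X j.+2.
    elim: j => [_|j IHj jN]; first by rewrite mul1r.
    rewrite (IHj (ltnW jN)) exprSr -mulrA /X (uS j.+2); last by nlia.
    rewrite (flip_prefix dom); last by nlia.
    by rewrite expr0 -[W in LHS]WE; ring.
  rewrite (h N.-1); last by nlia.
  rewrite ler_pM2l ?exprn_gt0 // /X.
  by have := ubound N.-1.+2 (ltac:(nlia)); rewrite ler_norml => /andP[b1 b2]; lra.
have tNL : t ^+ N.-1 * (2 * W) < t ^+ L.-1.
  have -> : N.-1 = (L.-1 + (N - L))%N by nlia.
  rewrite exprD -mulrA -[ltRHS]mulr1 ltr_pM2l ?exprn_gt0 //.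
  have : t ^+ (N - L) <= t ^+ 4 by apply: ler_wiXn2l; [lra|lra|nlia].
  have : t ^+ 4 <= (3 / 5) ^+ 4.
    by apply: lerXn2r => //; rewrite nnegrE; lra.
  have : (3 / 5) ^+ 4 <= 13 / 100 :> R by rewrite !exprS expr0; lra.
  move=> q1 q2 q3; have q4 : t ^+ (N - L) <= 13 / 100 by lra.
  have : t ^+ (N - L) * (2 * W) <= 13 / 100 * 5.
    by apply: ler_pM; rewrite ?exprn_ge0 ?(ltW t0) //; lra.
  lra.
have lt_u : u k.+1 < u 2%N by rewrite /X in Xk X2; lra.
rewrite uS // fk expr1.
have : t * u 1%N = -1 by lra.
rewrite (uS 1%N) // (flip1 dom) // expr1.
have : t * u k.+1 < t * u 2%N by rewrite ltr_pM2l.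
nra.
Qed.
End Tent.

(** * Dominant words and quadratic maps *)

Lemma quad_beta_eq (R : realType) (c : R) : c <= 1 / 4 ->
  quad_beta c ^+ 2 = quad_beta c - c.
Proof.
move=> c4; have h : Num.sqrt (1 - 4 * c) ^+ 2 = 1 - 4 * c by rewrite sqr_sqrtr; lra.
rewrite /quad_beta; move: h; move: (Num.sqrt _) => s h.
have -> : ((1 + s) / 2) ^+ 2 = (1 + 2 * s + s ^+ 2) / 4 by field.
by rewrite h; lra.
Qed.

Lemma quad_beta_ge_half (R : realType) (c : R) : 1 / 2 <= quad_beta c.
Proof. by rewrite /quad_beta; have := sqrtr_ge0 (1 - 4 * c); lra. Qed.

Lemma quad_beta_le2 (R : realType) (c : R) : -2 <= c <= 1 / 4 -> quad_beta c <= 2.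
Proof.
move=> /andP[c2 c4]; have := quad_beta_eq c4; have := quad_beta_ge_half c.
by move: (quad_beta c) => b; nra.
Qed.

Definition pull_step (R : realType) (c : R) (b : bool) (v : R) : R :=
  (-1) ^+ b * Num.sqrt (v - c).

Lemma continuous_back_orbit (R : realType) (e : nat -> bool) p j :
  continuous (fun c : R => back_orbit 0 (pull_step c) e p j).
Proof.
elim: j => [|j IHj] c /=; first exact: cvg_cst.
rewrite /pull_step; apply: cvgM; first exact: cvg_cst.
apply: (@continuous_comp _ _ _ (fun c : R => back_orbit 0 (pull_step c) e p j - c) Num.sqrt).
  by apply: cvgB; [exact: IHj | exact: cvg_id].
exact: sqrt_continuous.
Qed.

(** Pulling back by the right branch contracts towards the fixed point b at
    least by 10/19, as b^2 - y^2 = b - y'. *)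
Lemma contract_near_beta (R : realFieldType) (b c y y' : R) :
  y ^+ 2 = y' - c -> b ^+ 2 = b - c -> 0 <= y <= b -> 19 / 10 <= b ->
  b - y <= (19/10)^-1 * (b - y').
Proof.
move=> ysq bsq /andP[y0 yb] b1.
have -> : b - y' = (b - y) * (b + y) by rewrite -subr_sqr; lra.
by rewrite ler_pdivlMl; [nra | lra].
Qed.

(** The same pullback contracts at most by 1/4. *)
Lemma escape_from_beta (R : realFieldType) (b c y y' : R) :
  y ^+ 2 = y' - c -> b ^+ 2 = b - c -> 0 <= y <= b -> b <= 2 ->
  1 / 4 * (b - y') <= b - y.
Proof.
move=> ysq bsq /andP[y0 yb] b2.
have -> : b - y' = (b - y) * (b + y) by rewrite -subr_sqr; lra.
nra.
Qed.

(** (10/19)^3 < 1/4, which is why the initial run is required to be three times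
    as long as the others. *)
Lemma pow_gap (R : realFieldType) (N L : nat) : (1 < L)%N -> (3 * L <= N)%N ->
  (19/10)^-1 ^+ (N - 2) < (1/4) ^+ L.-1 :> R.
Proof.
move=> L1 NL; apply: (@le_lt_trans _ _ (((19/10)^-1 ^+ 3) ^+ L.-1 * (19/10)^-1)).
  by rewrite -exprM -exprSr; apply: ler_wiXn2l; [lra|lra|nlia].
apply: (@lt_le_trans _ _ (((19/10)^-1 ^+ 3) ^+ L.-1)).
  by rewrite -[ltRHS]mulr1 ltr_pM2l ?exprn_gt0 ?invr_gt0 //; lra.
have q3 : (19/10)^-1 ^+ 3 <= 1/4 :> R by rewrite !exprS expr0; lra.
by apply: lerXn2r => //; rewrite nnegrE ?exprn_ge0 ?invr_ge0 //; lra.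
Qed.

Lemma pullback_le (R : realType) (a : nat -> bool) p N L (c : R) (y : nat -> R) :
  dominant a p N L -> -2 <= c <= -(7/4) -> y p = 0 ->
  (forall k, (0 < k < p)%N -> y k = pull_step c (flip a k) (y k.+1)) ->
  forall k, (0 < k <= p)%N -> `|y k| <= quad_beta c.
Proof.
move=> dom /andP[c2 c7] yp yS k kp.
have bE : quad_beta c ^+ 2 = quad_beta c - c by apply: quad_beta_eq; lra.
have b2 := quad_beta_ge_half c.
have -> : k = (p - (p - k))%N by nlia.
have : (p - k < p)%N by nlia.
elim: (p - k)%N => [_|j IHj jp]; first by rewrite subn0 yp normr0; lra.
rewrite yS; last by nlia.
rewrite /pull_step normrM normr_sign mul1r ger0_norm ?sqrtr_ge0 //.
rewrite -[leRHS]ger0_norm; last by lra.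
rewrite -sqrtr_sqr ler_sqrt ?sqr_ge0 // bE lerB // subnSK //; last by nlia.
by rewrite (le_trans (ler_norm _)) // IHj //; nlia.
Qed.

(** The square root of a negative number is 0, so a pullback that leaves the
    domain of the inverse branches would be clamped.  This does not happen if
    y_1 = c: by dominance y_2 is closer to the fixed point than any later
    y_(k+1) with y_k < 0, so that y_k stays above c.  The lower
    bound on y_2 gives the sign of y_1(c) - c at c = -7/4. *)
Lemma pullback_unclamped (R : realType) (a : nat -> bool) p N L (c : R) (y : nat -> R) :
  dominant a p N L -> -2 <= c <= -(7/4) -> y p = 0 ->
  (forall k, (0 < k < p)%N -> y k = pull_step c (flip a k) (y k.+1)) ->
  21 / 16 <= y 2%N /\ (y 1%N = c -> forall k, (1 < k <= p)%N -> c < y k).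
Proof.
move=> dom c27 yp yS; have yle := pullback_le dom c27 yp yS.
case/andP: c27 => c2 c7.
have [a0 aN Np [NL L1] _] := dom.
have N0 : (0 < N)%N by nlia.
have p1 : (0 < 1 < p)%N by nlia.
have c14 : -2 <= c <= 1 / 4 by apply/andP; split; lra.
have bE : quad_beta c ^+ 2 = quad_beta c - c by apply: quad_beta_eq; lra.
have b2 := quad_beta_le2 c14.
have b1 : 19 / 10 <= quad_beta c.
  by move: (quad_beta_ge_half c) bE c7; move: (quad_beta c) => b; nra.
move: (quad_beta c) bE b2 b1 yle => b bE b2 b1 yle.
pose X k := (b - y k) / b.
have b0 : 0 < b by lra.
have y_pos k : (0 < k < p)%N -> flip a k = false -> 0 <= y k.
  by move=> kp fk; rewrite yS // fk /pull_step expr0 mul1r sqrtr_ge0.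
have X2 : X 2%N <= (19/10)^-1 ^+ (N - 2).
  have h j : (j <= N - 2)%N -> X 2%N <= (19/10)^-1 ^+ j * X j.+2.
    elim: j => [_|j IHj jN]; first by rewrite mul1r.
    apply: (le_trans (IHj (ltnW jN))); rewrite exprSr -mulrA.
    rewrite ler_pM2l; last by rewrite exprn_gt0 // invr_gt0; lra.
    have fj : flip a j.+2 = false by apply: (flip_prefix dom); nlia.
    have y2 : 0 <= y j.+2 by apply: y_pos => //; nlia.
    have y3 : 0 <= y j.+3 by apply: y_pos; [nlia|apply: (flip_prefix dom); nlia].
    have ysq : y j.+2 ^+ 2 = y j.+3 - c.
      rewrite yS; last by nlia.
      by rewrite fj /pull_step expr0 mul1r sqr_sqrtr //; lra.
    rewrite /X mulrA ler_pM2r ?invr_gt0 //.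
    have y2b : y j.+2 <= b.
      by rewrite (le_trans (ler_norm _)) // yle //; nlia.
    by apply: (contract_near_beta ysq bE) => //; rewrite y2.
  apply: (le_trans (h _ (leqnn _))).
  apply: ler_piMr; first by rewrite exprn_ge0 // invr_ge0; lra.
  rewrite /X ler_pdivrMr // mul1r gerBl; apply: y_pos; first by nlia.
  by apply: (flip_prefix dom); nlia.
split.
  have : X 2%N <= 100 / 361.
    apply: (le_trans X2); apply: (@le_trans _ _ ((19/10)^-1 ^+ 2)).
      by apply: ler_wiXn2l; [lra|lra|nlia].
    by rewrite expr2; lra.
  by rewrite /X ler_pdivrMr //; lra.
move=> y1 k /andP[k1 kp].
have [->|kp'] := eqVneq k p; first by rewrite yp; lra.
have kp2 : (0 < k < p)%N by nlia.
case fk: (flip a k); last by have := y_pos k kp2 fk; lra.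
have Nk : (N < k)%N.
  by rewrite ltnNge; apply/negP => kN; move: fk; rewrite (flip_prefix dom) //; nlia.
have Xk : (1/4) ^+ L.-1 <= X k.+1.
  have [r rL hr] := flip_run_end dom (ltac:(nlia) : (N.+1 < k.+1 <= p)%N).
  apply: (@le_trans _ _ ((1/4) ^+ r)).
    by apply: ler_wiXn2l; [lra|lra|nlia].
  apply: (@deficit_ladder _ (flip a) X (1/4) p) => //.
  - by apply/andP; split; lra.
  - by rewrite /X yp subr0 divff // gt_eqF.
  - move=> i hi fi; rewrite /X ler_pdivlMr // mul1r lerDl oppr_ge0 (yS i) // /pull_step fi.
    by rewrite expr1 mulN1r oppr_le0 sqrtr_ge0.
  - move=> i hi fi; rewrite /X mulrA ler_pM2r ?invr_gt0 //.
    have yi := y_pos i hi fi.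
    have yib : y i <= b by rewrite (le_trans (ler_norm _)) // yle //; nlia.
    have yi1 : - b <= y i.+1.
      by have := yle i.+1 (ltac:(nlia)); rewrite ler_norml => /andP[].
    have [hc|hc] := lerP c (y i.+1); last first.
      have : y i = 0.
        rewrite yS // fi /pull_step expr0 mul1r; apply/eqP; rewrite sqrtr_eq0; lra.
      by lra.
    have ysq : y i ^+ 2 = y i.+1 - c.
      by rewrite yS // fi /pull_step expr0 mul1r sqr_sqrtr //; lra.
    by apply: (escape_from_beta ysq bE) => //; rewrite yi.
have X2k : X 2%N < X k.+1.
  apply: (le_lt_trans X2); apply: (lt_le_trans _ Xk).
  exact: pow_gap.
have lty : y k.+1 < y 2%N.
  by move: X2k; rewrite /X ltr_pM2r ?invr_gt0 // ltrD2l ltrN2.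
have y20 : 0 <= y 2%N by apply: y_pos; [nlia|apply: (flip_prefix dom); nlia].
rewrite yS // /pull_step fk expr1 mulN1r ltrNr.
have := yS 1%N p1; rewrite y1 /pull_step (flip1 dom) // expr1 mulN1r => cE.
rewrite {2}cE opprK ltr_sqrt; last by lra.
by rewrite ltrD2r.
Qed.

(** The intermediate value theorem for y_1(c) - c on [-2, -7/4], where y_1(c) is
    the pullback of 0 along the itinerary. *)
Lemma quad_parameter (R : realType) (a : nat -> bool) p N L : dominant a p N L ->
  exists c : R,
  [/\ -2 <= c <= -(7/4), iter p (quad c) 0 = 0 &
    forall k, (0 < k < p)%N -> Num.sg (iter k (quad c) 0) = (-1) ^+ flip a k].
Proof.
move=> dom; have [a0 aN Np [NL L1] _] := dom.
have N0 : (0 < N)%N by nlia.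
have p1 : (0 < 1 < p)%N by nlia.
pose y (c : R) k := back_orbit 0 (pull_step c) (flip a) p (p - k).
have yp c : y c p = 0 by rewrite /y subnn.
have yS c k : (0 < k < p)%N -> y c k = pull_step c (flip a k) (y c k.+1).
  exact: back_orbitS.
have y1E c : y c 1%N = - Num.sqrt (y c 2%N - c).
  by rewrite yS // /pull_step (flip1 dom) // expr1 mulN1r.
have [|||c cI yc] := @IVT R (fun c => y c 1%N - c) (-2) (-(7/4)) 0.
- lra.
- apply: continuous_subspaceT => c; apply: cvgB; last exact: cvg_id.
  exact: continuous_back_orbit.
- rewrite ge_min le_max; apply/andP; split; apply/orP; [right|left].
    rewrite y1E subr_le0 lerNl opprK.
    have [|h _] := pullback_unclamped dom (c := -(7/4)) _ (yp _) (yS _).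
      by apply/andP; split; lra.
    have {1}-> : 7 / 4 = Num.sqrt ((7/4) ^+ 2) :> R by rewrite sqrtr_sqr ger0_norm //; lra.
    by rewrite ler_wsqrtr // expr2; lra.
  have h : `|y (-2) 1%N| <= quad_beta (-2).
    apply: (pullback_le dom _ (yp _) (yS _)); first by apply/andP; split; lra.
    by nlia.
  have : quad_beta (-2 : R) <= 2 by apply: quad_beta_le2; apply/andP; split; lra.
  by move: h; rewrite ler_norml => /andP[]; lra.
have c27 : -2 <= c <= -(7/4) by move: cI; rewrite in_itv.
have {}yc : y c 1%N = c by move: yc; lra.
have [_ /(_ yc) clt] := pullback_unclamped dom c27 (yp _) (yS _).
have orb k : (0 < k <= p)%N -> iter k (quad c) 0 = y c k.
  elim: k => [//|k IHk] kp; rewrite iterS.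
  have [->|k0] := eqVneq k 0%N; first by rewrite /= /quad expr0n add0r yc.
  rewrite IHk; last by nlia.
  have ck : c < y c k.+1 by apply: clt; nlia.
  rewrite (yS c k); last by nlia.
  rewrite /quad /pull_step exprMn sqrr_sign mul1r sqr_sqrtr ?subrK //.
  by rewrite subr_ge0 ltW.
exists c; split => //; first by rewrite orb ?yp //; nlia.
move=> k kp; rewrite orb; last by nlia.
have ck : c < y c k.+1 by apply: clt; nlia.
rewrite yS // /pull_step sgrM [Num.sg (Num.sqrt _)]gtr0_sg ?mulr1.
  by case: (flip a k); rewrite ?expr0 ?expr1 ?sgrN sgr1.
by rewrite sqrtr_gt0 subr_gt0.
Qed.

(** * Counting turning points *)

Fixpoint quad_iter_poly (R : realType) (c : R) (i : nat) : {poly R} :=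
  if i is j.+1 then quad_iter_poly c j ^+ 2 + c%:P else 'X.

Lemma quad_iter_polyE (R : realType) (c : R) i x :
  (quad_iter_poly c i).[x] = iter i (quad c) x.
Proof. by elim: i => [|i IHi] /=; rewrite !hornerE // IHi. Qed.

Lemma quadB (R : realType) (c a b : R) : quad c b - quad c a = (b - a) * (b + a).
Proof. by rewrite /quad; ring. Qed.

Lemma iter_quad_sign_change (R : realType) (c : R) i (a b : R) : a <= b ->
  iter i (quad c) a * iter i (quad c) b < 0 ->
  exists2 z, a < z < b & iter i (quad c) z = 0.
Proof.
rewrite -!quad_iter_polyE => ab; set q := quad_iter_poly c i => qab.
have hz z : a <= z <= b -> root q z -> exists2 z, a < z < b & iter i (quad c) z = 0.
  move=> /andP[az zb] rz; exists z; last by rewrite -quad_iter_polyE; exact/rootP.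
  rewrite !lt_neqAle az zb !andbT; apply/andP; split.
    by apply: contraTneq qab => ->; rewrite (rootP rz) mul0r ltxx.
  by apply: contraTneq qab => <-; rewrite (rootP rz) mulr0 ltxx.
have [qa|qa] := lerP q.[a] 0.
  have [|z zab rz] := @poly_ivt R q a b ab; last exact: (hz z).
  by rewrite qa; nra.
have [|z zab rz] := @poly_ivt R (- q) a b ab.
  by rewrite !hornerN; apply/andP; split; nra.
by apply: (hz z) => //; rewrite rootN in rz.
Qed.

(** The first n iterates are monotone between a and b. *)
Definition no_turning (R : realType) (c : R) (n : nat) (a b : R) : Prop :=
  forall i z, (i < n)%N -> a < z < b -> iter i (quad c) z != 0.

Lemma no_turning_same_side (R : realType) (c : R) n (a b : R) i : a <= b ->
  no_turning c n a b -> (i < n)%N -> 0 <= iter i (quad c) a * iter i (quad c) b.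
Proof.
move=> ab nt i_n; rewrite leNgt; apply/negP => /(iter_quad_sign_change ab)[z zab iz].
by have := nt i z i_n zab; rewrite iz eqxx.
Qed.

(** Two distinct points on the same closed side of 0, with the sign [e] of this
    side; one of them may be 0. *)
Lemma same_side_sign (R : realDomainType) (x y : R) : x != y -> 0 <= x * y ->
  exists e : bool, [/\ 0 <= (-1) ^+ e * x, 0 <= (-1) ^+ e * y & 0 < (-1) ^+ e * (x + y)].
Proof.
move=> xy pxy; have [s0|s0] := ltrP 0 (x + y).
  by exists false; rewrite expr0 !mul1r; split => //; nra.
have s1 : x + y < 0.
  rewrite lt_neqAle s0 andbT; apply: contraNneq xy => e.
  have ye : y = - x by lra.
  by apply/eqP; nra.
by exists true; rewrite expr1 !mulN1r; split; nra.
Qed.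

Lemma no_turning_monotone (R : realType) (c : R) n (a b : R) j : a < b ->
  no_turning c n a b -> (j <= n)%N ->
  exists e : bool, 0 < (-1) ^+ e * (iter j (quad c) b - iter j (quad c) a).
Proof.
move=> ab nt; elim: j => [_|j IHj jn].
  by exists false; rewrite expr0 mul1r subr_gt0.
have [e he] := IHj (ltnW jn).
have ne : iter j (quad c) a != iter j (quad c) b.
  by apply: contraTneq he => ->; rewrite subrr mulr0 ltxx.
have [e' [_ _ h]] := same_side_sign ne (no_turning_same_side (ltW ab) nt jn).
exists (e (+) e'); rewrite !iterS quadB signr_addb.
have := mulr_gt0 he h; rewrite [X in _ -> _ < _ * (_ * X)]addrC.
by congr (0 < _); ring.
Qed.

Lemma telescope_bounds (R : realFieldType) (g : nat -> R) (d D : R) n :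
  (forall i, (i.+1 < n)%N -> d <= g i.+1 - g i <= D) ->
  forall i k, (i + k < n)%N -> k%:R * d <= g (i + k)%N - g i <= k%:R * D.
Proof.
move=> h i; elim=> [|k IHk] ikn; first by rewrite addn0 subrr !mul0r lexx.
have ik : (i + k < n)%N by rewrite (leq_ltn_trans _ ikn) // leq_add2l.
have := IHk ik; have := h (i + k)%N; rewrite -addnS => /(_ ikn).
rewrite [k.+1%:R]mulrSr !mulrDl !mul1r => /andP[h1 h2] /andP[h3 h4].
by apply/andP; split; lra.
Qed.

(** A finite list that contains the zeros of the k-th iterate; the square root
    of a negative number is 0, so it may contain other points. *)
Fixpoint zero_candidates (R : realType) (c : R) (k : nat) : seq R :=
  if k is j.+1 then
    flatten [seq [:: Num.sqrt (y - c); - Num.sqrt (y - c)] | y <- zero_candidates c j]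
  else [:: 0].

Lemma mem_zero_candidates (R : realType) (c : R) k z :
  iter k (quad c) z = 0 -> z \in zero_candidates c k.
Proof.
elim: k z => [|k IHk] z /=; first by rewrite inE => ->.
rewrite -iterS iterSr => /IHk h; apply/flattenP.
exists [:: Num.sqrt (quad c z - c); - Num.sqrt (quad c z - c)].
  by apply/mapP; exists (quad c z).
rewrite /quad addrK sqrtr_sqr !inE; by case: ger0P => _; rewrite ?opprK eqxx ?orbT.
Qed.

Definition turning_points (R : realType) (c : R) (n : nat) : seq R :=
  sort <=%R (undup [seq z <- flatten [seq zero_candidates c i | i <- iota 0 n] |
    has (fun i => iter i (quad c) z == 0) (iota 0 n)]).

Lemma mem_turning_points (R : realType) (c : R) n z :
  reflect (exists2 i, (i < n)%N & iter i (quad c) z = 0) (z \in turning_points c n).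
Proof.
rewrite mem_sort mem_undup mem_filter.
apply: (iffP andP) => [[/hasP[k]]|[i i_n hi]].
  by rewrite mem_iota add0n /= => k_n /eqP hk _; exists k.
split; first by apply/hasP; exists i; rewrite ?mem_iota ?hi.
apply/flattenP; exists (zero_candidates c i); last exact: mem_zero_candidates.
by apply/mapP; exists i; rewrite // mem_iota.
Qed.

Lemma sorted_turning_points (R : realType) (c : R) n : sorted <%R (turning_points c n).
Proof. by rewrite sort_lt_sorted undup_uniq. Qed.

Lemma turning_points_adjacent (R : realType) (c : R) n i :
  (i.+1 < size (turning_points c n))%N ->
  let a := nth 0 (turning_points c n) i in let b := nth 0 (turning_points c n) i.+1 in
  [/\ a < b, a \in turning_points c n, b \in turning_points c n & no_turning c n a b].
Proof.
move=> i1; have i0 := ltnW i1; split; rewrite ?mem_nth //.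
  by rewrite (lt_sorted_ltn_nth 0 (sorted_turning_points c n)) ?inE.
move=> k z kn /andP[az zb]; apply/negP => /eqP hz.
have : z \in turning_points c n by apply/mem_turning_points; exists k.
move/(nthP 0) => [j js zE]; move: az zb; rewrite -zE.
rewrite !(lt_sorted_ltn_nth 0 (sorted_turning_points c n)) ?inE //.
by rewrite ltnS => /leq_trans h /h; rewrite ltnn.
Qed.

Section Kneading.
Variables (R : realType) (c t : R) (p : nat) (u : nat -> R).
Local Notation f := (quad c).
Local Notation x k := (iter k f 0).
Hypotheses (c_range : -2 <= c < 0) (t_range : 0 < t < 1) (p_gt0 : (0 < p)%N).
Hypothesis periodic : x p = 0.
Hypothesis u_p : u p = 0.
Hypothesis u_rec : forall k, (0 < k < p)%N -> u k = Num.sg (x k) * (1 + t * u k.+1).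
Hypothesis u_1 : 1 + t * u 1%N = 0.
Hypothesis u_gt : forall k, (1 < k <= p)%N -> 0 < 1 + t * u k.

Definition preimage0 (z : R) : Prop := exists k, iter k f z = 0.

Fixpoint theta_trunc n z : R :=
  if n is m.+1 then Num.sg z * (1 + t * theta_trunc m (f z)) else 0.

(** The kneading function, the sum of t^j times the signs of the slopes of the
    iterates at z.  On preimages of 0 it is a finite sum, which does not depend
    on where it is cut after the first visit to 0. *)
Definition theta z : R := theta_trunc (get [set k | iter k f z = 0]) z.

Lemma theta_trunc_stable k d z : iter k f z = 0 ->
  theta_trunc (k + d) z = theta_trunc k z.
Proof.
elim: k z => [|k IHk] z hz /=.
  by case: d => //= d; rewrite (hz : z = 0) sgr0 mul0r.
by rewrite IHk // -iterSr.
Qed.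

Lemma thetaE k z : iter k f z = 0 -> theta z = theta_trunc k z.
Proof.
move=> hz; rewrite /theta; have := @getPex _ [set k | iter k f z = 0] (ex_intro _ k hz).
move: (get _) => m /= hm.
have [km|/ltnW mk] := leqP k m.
  by rewrite -(subnKC km) theta_trunc_stable.
by rewrite -(subnKC mk) theta_trunc_stable.
Qed.

Lemma iter_period m : iter (m * p) f 0 = 0.
Proof. by elim: m => [//|m IHm]; rewrite mulSn iterD IHm. Qed.

Lemma preimage0_late z n : preimage0 z -> exists2 k, (n <= k)%N & iter k f z = 0.
Proof.
move=> [k hk]; exists (n * p + k)%N; last by rewrite iterD hk iter_period.
by rewrite (leq_trans (leq_pmulr n p_gt0)) // leq_addr.
Qed.

Lemma preimage0_quad z : preimage0 z -> preimage0 (f z).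
Proof.
by move=> /(preimage0_late 1)[[|k] // _ hk]; exists k; rewrite -iterSr.
Qed.

Lemma preimage0_iter k z : preimage0 z -> preimage0 (iter k f z).
Proof. by move=> hz; elim: k => [//|k IHk]; rewrite iterS; exact: preimage0_quad. Qed.

Lemma preimage0_orbit k : preimage0 (x k).
Proof. by apply: preimage0_iter; exists 0%N. Qed.

Lemma theta0 : theta 0 = 0. Proof. by rewrite (@thetaE 0%N). Qed.

Lemma theta_rec z : preimage0 z -> theta z = Num.sg z * (1 + t * theta (f z)).
Proof.
move=> /(preimage0_late 1)[[|k] // _ hk].
by rewrite (thetaE hk) (@thetaE k) // -iterSr.
Qed.

Lemma theta_le z : `|theta z| <= (1 - t)^-1.
Proof.
case/andP: t_range => t0 t1.
have W0 : 0 <= (1 - t)^-1 by rewrite invr_ge0 subr_ge0 ltW.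
rewrite /theta; move: (get _) => n; elim: n z => [|n IHn] z /=; first by rewrite normr0.
rewrite normrM; apply: (@le_trans _ _ (1 * `|1 + t * theta_trunc n (f z)|)).
  by rewrite ler_wpM2r // normr_sg; case: (z != 0).
rewrite mul1r (le_trans (ler_normD _ _)) // normr1 normrM (gtr0_norm t0).
have -> : (1 - t)^-1 = 1 + t * (1 - t)^-1 by field; rewrite subr_eq0 gt_eqF.
by rewrite lerD2l ler_pM2l.
Qed.

Lemma theta_orbit k : (0 < k <= p)%N -> theta (x k) = u k.
Proof.
move=> kp; have -> : k = (p - (p - k))%N by lia.
have : (p - k < p)%N by lia.
elim: (p - k)%N => [_|j IHj jp]; first by rewrite subn0 periodic theta0 u_p.
rewrite u_rec; last by lia.
rewrite theta_rec; last exact: preimage0_orbit.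
have E : f (x (p - j.+1)) = x (p - j) by rewrite -(subnSK (ltnW jp)).
by rewrite E (subnSK (ltnW jp)) IHj // ltnW.
Qed.

(** This is the equation of the kneading parameter t, and it makes [theta]
    continuous at 0. *)
Lemma theta_critical_value : 1 + t * theta (f 0) = 0.
Proof. by rewrite -[f 0]/(x 1) theta_orbit ?u_1 //; lia. Qed.

(** The sign of z may be replaced by that of either closed side when z = 0, by
    [theta_critical_value]. *)
Lemma theta_side (e : bool) z : preimage0 z -> 0 <= (-1) ^+ e * z ->
  theta z = (-1) ^+ e * (1 + t * theta (f z)).
Proof.
move=> hz ez; rewrite theta_rec //.
have [->|z0] := eqVneq z 0; first by rewrite theta_critical_value !mulr0.
congr (_ * _); case: e ez; rewrite ?expr0 ?expr1 ?mul1r ?mulN1r => ez.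
  by rewrite ltr0_sg // lt_neqAle z0 -oppr_ge0.
by rewrite gtr0_sg // lt_neqAle eq_sym z0.
Qed.

Lemma theta_step (e : bool) a b : preimage0 a -> preimage0 b ->
  0 <= (-1) ^+ e * a -> 0 <= (-1) ^+ e * b ->
  theta b - theta a = (-1) ^+ e * t * (theta (f b) - theta (f a)).
Proof. by move=> ha hb ea eb; rewrite (theta_side ha ea) (theta_side hb eb); ring. Qed.

Definition in_orbit z : Prop := exists2 k, (k < p)%N & z = x k.

Lemma in_orbit_quad z : in_orbit z -> in_orbit (f z).
Proof.
move=> [k kp ->]; have [e|ne] := eqVneq k.+1 p.
  by exists 0%N => //; rewrite -[f _]iterS e periodic.
by exists k.+1; rewrite // ltn_neqAle ne.
Qed.

Lemma in_orbit_preimage0 z : in_orbit z -> preimage0 z.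
Proof. by move=> [k _ ->]; exact: preimage0_orbit. Qed.

Lemma theta_orbit_sign z : in_orbit z -> z != 0 -> 0 < z * theta z.
Proof.
move=> [[|k] kp ->] z0; first by rewrite eqxx in z0.
rewrite theta_rec; last exact: preimage0_orbit.
rewrite mulrA [X in X * _]mulrC -normrEsg mulr_gt0 ?normr_gt0 //.
by rewrite -[f (x _)]iterS theta_orbit ?u_gt //; lia.
Qed.

(** Two points on the same side of 0 are compared through their images; when
    one of them reaches 0, or when they are on different sides, the signs
    decide. *)
Lemma theta_orbit_increasing a b : in_orbit a -> in_orbit b -> a != b ->
  0 < (b - a) * (theta b - theta a).
Proof.
move=> oa; have [n hn] := in_orbit_preimage0 oa.
elim: n a b oa hn => [|n IHn] a b oa hn ob ab.
  rewrite (hn : a = 0) theta0 !subr0; apply: theta_orbit_sign => //.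
  by rewrite eq_sym -(hn : a = 0).
have [pab|nab] := lerP 0 (a * b).
  have [e [ea eb eab]] := same_side_sign ab pab.
  rewrite (theta_step (in_orbit_preimage0 oa) (in_orbit_preimage0 ob) ea eb).
  have fab : f a != f b.
    have ab0 : b + a != 0.
      by rewrite addrC; apply: contraTneq eab => ->; rewrite mulr0 ltxx.
    by rewrite eq_sym -subr_eq0 quadB mulf_neq0 // subr_eq0 eq_sym.
  have := IHn (f a) (f b) (in_orbit_quad oa); rewrite -iterSr => /(_ hn (in_orbit_quad ob) fab).
  rewrite quadB; case/andP: t_range => t0 _.
  move: (theta (f b) - theta (f a)) => T h.
  have h2 : 0 < ((-1) ^+ e * (b - a) * T) * ((-1) ^+ e * (a + b)).
    have -> : ((-1) ^+ e * (b - a) * T) * ((-1) ^+ e * (a + b)) =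
       ((-1) ^+ e) ^+ 2 * ((b - a) * (b + a) * T) by ring.
    by rewrite sqrr_sign mul1r.
  rewrite (pmulr_lgt0 _ eab) in h2.
  have -> : (b - a) * ((-1) ^+ e * t * T) = t * ((-1) ^+ e * (b - a) * T) by ring.
  exact: mulr_gt0.
have a0 : a != 0 by apply: contraTneq nab => ->; rewrite mul0r ltxx.
have b0 : b != 0 by apply: contraTneq nab => ->; rewrite mulr0 ltxx.
have := theta_orbit_sign oa a0; have := theta_orbit_sign ob b0.
move: (theta a) (theta b) => A B hB hA.
by have [a1|a1] := ltrP 0 a; nra.
Qed.

(** [theta_step] iterated as long as a and b stay on the same side of 0. *)
Lemma theta_gap_exact n a b : a < b -> preimage0 a -> preimage0 b ->
  no_turning c n a b -> forall j, (j <= n)%N ->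
  exists e : bool, 0 < (-1) ^+ e * (iter j f b - iter j f a) /\
   theta b - theta a = (-1) ^+ e * t ^+ j * (theta (iter j f b) - theta (iter j f a)).
Proof.
move=> ab ha hb nt; elim=> [_|j IHj jn].
  by exists false; rewrite !expr0 !mul1r subr_gt0.
have [e [he te]] := IHj (ltnW jn).
have ne : iter j (quad c) a != iter j (quad c) b.
  by apply: contraTneq he => ->; rewrite subrr mulr0 ltxx.
have [e' [ea eb h]] := same_side_sign ne (no_turning_same_side (ltW ab) nt jn).
exists (e (+) e'); rewrite !iterS; split.
  rewrite quadB signr_addb.
  have := mulr_gt0 he h; rewrite [X in _ -> _ < _ * (_ * X)]addrC.
  by congr (0 < _); ring.
rewrite te (theta_step (preimage0_iter j ha) (preimage0_iter j hb) ea eb).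
by rewrite signr_addb exprS; ring.
Qed.

Lemma orbit_separation : exists2 m : R, 0 < m &
  forall a b, in_orbit a -> in_orbit b -> a != b -> m <= `|theta b - theta a|.
Proof.
pose F (ij : 'I_p * 'I_p) :=
  if x ij.1 == x ij.2 then 1 else `|theta (x ij.2) - theta (x ij.1)|.
exists (\big[Order.min/1]_(ij : 'I_p * 'I_p) F ij).
  apply: lt_bigmin => // -[i j] _; rewrite /F /=; case: eqP => // /eqP ne.
  rewrite normr_gt0; apply/negP => /eqP e.
  have := @theta_orbit_increasing (x i) (x j); rewrite e mulr0 ltxx => h.
  by apply: notF; apply: h => //; [exists i|exists j].
move=> a b [i ip ->] [j jp ->] ne.
by rewrite (le_trans (bigmin_le _ (Ordinal ip, Ordinal jp) _)) // /F /= (negPf ne).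
Qed.

(** The n-th images of consecutive turning points are distinct points of the
    finite critical orbit, whose [theta]-distances are bounded above and away
    from 0. *)
Lemma theta_gap : exists2 m : R, 0 < m & forall n a b, a < b ->
  (exists2 i, (i < n)%N & iter i f a = 0) -> (exists2 i, (i < n)%N & iter i f b = 0) ->
  no_turning c n a b ->
  m * t ^+ n <= theta b - theta a <= 2 / (1 - t) * t ^+ n.
Proof.
have [m m0 hm] := orbit_separation.
have orb n z : (exists2 i, (i < n)%N & iter i f z = 0) -> in_orbit (iter n f z).
  move=> [i i_n hi]; rewrite -(subnK (ltnW i_n)) iterD hi.
  elim: (n - i)%N => [|k IHk]; first by exists 0%N.
  by rewrite iterS; exact: in_orbit_quad.
case/andP: t_range => t0 t1.
exists m => // n a b ab ha hb nt.
have pa : preimage0 a by case: ha => i _ hi; exists i.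
have pb : preimage0 b by case: hb => i _ hi; exists i.
have [e [he te]] := theta_gap_exact ab pa pb nt (leqnn n).
have oa := orb _ _ ha; have ob := orb _ _ hb.
have ne : iter n f a != iter n f b.
  by apply: contraTneq he => ->; rewrite subrr mulr0 ltxx.
have inc := theta_orbit_increasing oa ob ne.
have E : theta b - theta a = t ^+ n * `|theta (iter n f b) - theta (iter n f a)|.
  rewrite te; move: inc he; move: (iter n f b - iter n f a) (theta _ - theta _) => X T XT.
  case: e {te} => /=; rewrite ?expr0 ?expr1 ?mulN1r ?mul1r => he.
    by rewrite ltr0_norm; [ring | nra].
  by rewrite gtr0_norm; [|nra].
rewrite E ![_ * t ^+ n]mulrC; apply/andP; split.
  by rewrite ler_pM2l ?exprn_gt0 //; exact: hm.
rewrite ler_pM2l ?exprn_gt0 // (le_trans (ler_normB _ _)) //.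
by have := theta_le (iter n f b); have := theta_le (iter n f a); rewrite mulrDl !mul1r; lra.
Qed.

(** The gaps, of size at least m t^n, add up to at most the oscillation of
    [theta]. *)
Lemma size_turning_points_le : exists2 C : R, 0 < C &
  forall n, (size (turning_points c n))%:R <= C * t ^- n.
Proof.
have [m m0 gap] := theta_gap; case/andP: t_range => t0 t1.
have W0 : 0 < (1 - t)^-1 by rewrite invr_gt0 subr_gt0.
exists (1 + 2 * (1 - t)^-1 / m); first by rewrite addr_gt0 // divr_gt0 // mulr_gt0.
move=> n; set s := size _.
have tn : 1 <= t ^- n by rewrite invf_ge1 ?exprn_gt0 // exprn_ile1 // ltW.
have [->|s0] := eqVneq s 0%N.
  by rewrite mulr_ge0 ?(le_trans _ tn) // addr_ge0 // divr_ge0 ?mulr_ge0 // ltW.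
have h i : (i.+1 < s)%N -> m * t ^+ n <=
    theta (nth 0 (turning_points c n) i.+1) - theta (nth 0 (turning_points c n) i) <=
    2 / (1 - t) * t ^+ n.
  move=> /turning_points_adjacent[ab /mem_turning_points ha /mem_turning_points hb nt].
  exact: gap.
have s1 : (0 + s.-1 < s)%N by rewrite add0n prednK // lt0n.
have /andP[h1 _] := telescope_bounds h s1.
have hm : s.-1%:R * m <= 2 * (1 - t)^-1 * t ^- n.
  rewrite ler_pdivlMr ?exprn_gt0 // -mulrA (le_trans h1) // (le_trans (ler_norm _)) //.
  by rewrite (le_trans (ler_normB _ _)) // mulrDl mul1r lerD // theta_le.
have -> : s%:R = s.-1%:R + 1 :> R by rewrite -mulrSr prednK // lt0n.
rewrite mulrDl mul1r addrC lerD // [leRHS]mulrAC ler_pdivlMr //.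
Qed.

(** [theta] increases by 1 from 0 to the square root of -c, which are both
    turning points for n > 1, and each gap contributes at most a multiple of
    t^n. *)
Lemma size_turning_points_ge : exists2 C : R, 0 < C &
  forall n, (1 < n)%N -> C * t ^- n <= (size (turning_points c n))%:R.
Proof.
have [m m0 gap] := theta_gap; case/andP: t_range => t0 t1.
have W0 : 0 < 2 / (1 - t) by rewrite divr_gt0 // subr_gt0.
exists (2 / (1 - t))^-1; first by rewrite invr_gt0.
move=> n n1; set s := size _.
have h i : (i.+1 < s)%N -> m * t ^+ n <=
    theta (nth 0 (turning_points c n) i.+1) - theta (nth 0 (turning_points c n) i) <=
    2 / (1 - t) * t ^+ n.
  move=> /turning_points_adjacent[ab /mem_turning_points ha /mem_turning_points hb nt].
  exact: gap.
pose w := Num.sqrt (- c).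
have w0 : 0 < w by rewrite sqrtr_gt0 oppr_gt0; case/andP: c_range.
have fw : f w = 0 by rewrite /quad sqr_sqrtr ?addNr // oppr_ge0 ltW //; case/andP: c_range.
have zi : 0 \in turning_points c n by apply/mem_turning_points; exists 0%N => //; exact: ltnW.
have wi : w \in turning_points c n by apply/mem_turning_points; exists 1%N.
have tw : theta w = 1.
  by rewrite theta_rec; [rewrite fw theta0 mulr0 addr0 mulr1 gtr0_sg | exists 1%N].
have [/(nthP 0)[i is_ iE] /(nthP 0)[j js jE]] := (zi, wi).
have ij : (i < j)%N.
  by rewrite -(lt_sorted_ltn_nth 0 (sorted_turning_points c n)) ?inE // iE jE.
have ijs : (i + (j - i) < s)%N by rewrite subnKC // ltnW.
have /andP[_] := telescope_bounds h ijs.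
rewrite subnKC ?(ltnW ij) // iE jE theta0 tw subr0 => h1.
rewrite ler_pdivrMr ?exprn_gt0 // -[leLHS]mulr1 ler_pdivrMl //.
apply: (le_trans h1); rewrite mulrCA ler_pM2l // ler_pM2r ?exprn_gt0 //.
by rewrite ler_nat (leq_trans (leq_subr _ _)) // ltnW.
Qed.

End Kneading.

(** * Separation of orbits *)

Lemma quad_beta_stable (R : realType) (c x : R) : -2 <= c <= 1 / 4 ->
  `|x| <= quad_beta c -> `|quad c x| <= quad_beta c.
Proof.
move=> c24; have := quad_beta_le2 c24; case/andP: c24 => c2 c4.
have := quad_beta_eq c4; have := quad_beta_ge_half c.
rewrite /quad; move: (quad_beta c) => b b0 bE b2; rewrite !ler_norml => /andP[x1 x2].
by apply/andP; split; nra.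
Qed.

Lemma iter_quad_bounded (R : realType) (c x : R) k : -2 <= c <= 1 / 4 ->
  `|x| <= quad_beta c -> `|iter k (quad c) x| <= quad_beta c.
Proof. by move=> hc hx; elim: k => [//|k IHk]; rewrite iterS quad_beta_stable. Qed.

(** Outside the interval orbits stay outside. *)
Lemma preimage0_le_beta (R : realType) (c x : R) : -2 <= c <= 1 / 4 ->
  preimage0 c x -> `|x| <= quad_beta c.
Proof.
move=> /andP[c2 c4] [k hk]; rewrite leNgt; apply/negP => hx.
have esc y : quad_beta c < `|y| -> quad_beta c < `|quad c y|.
  have := quad_beta_eq c4; have := quad_beta_ge_half c; rewrite /quad -(real_normK (num_real y)).
  move: (quad_beta c) `|y| => b r b0 bE br; apply: lt_le_trans (ler_norm _).
  by nra.
have : quad_beta c < `|iter k (quad c) x| by elim: k {hk} => [//|k IHk]; exact: esc.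
by rewrite hk normr0; have := quad_beta_ge_half c; lra.
Qed.

Lemma iter_quad_critical_dist (R : realType) (c z : R) i : -2 <= c <= 1 / 4 ->
  `|z| <= quad_beta c ->
  `|iter i.+1 (quad c) z - iter i.+1 (quad c) 0| <= 4 ^+ i * z ^+ 2.
Proof.
move=> hc hz; have b2 := quad_beta_le2 hc.
have b0 : `|0 : R| <= quad_beta c by rewrite normr0; have := quad_beta_ge_half c; lra.
elim: i => [|i IHi].
  by rewrite /= quadB expr0 mul1r subr0 addr0 normrM -expr2 real_normK ?num_real.
rewrite iterS [iter i.+2 _ 0]iterS quadB normrM exprS mulrAC mulrC -mulrA.
apply: ler_pM => //; last by rewrite mulrC.
have := iter_quad_bounded i.+1 hc hz; have := iter_quad_bounded i.+1 hc b0.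
have := ler_normD (iter i.+1 (quad c) z) (iter i.+1 (quad c) 0); lra.
Qed.

Lemma same_sign_sg (R : realDomainType) (a b : R) : 0 < a * b ->
  Num.sg a = Num.sg b /\ Num.sg a * (b + a) = `|b + a|.
Proof.
move=> ab; have [a0|a0|a0] := ltrgt0P a.
- have b0 : 0 < b by rewrite -(pmulr_rgt0 _ a0).
  by rewrite !gtr0_sg // mul1r gtr0_norm // addr_gt0.
- have b0 : b < 0 by rewrite -(nmulr_rgt0 _ a0).
  by rewrite !ltr0_sg // mulN1r ltr0_norm // -oppr_gt0 opprD addr_gt0 // oppr_gt0.
- by move: ab; rewrite a0 mul0r ltxx.
Qed.

Section Periodic.
Variables (R : realType) (c : R) (p : nat).
Local Notation f := (quad c).
Hypotheses (c_range : -2 <= c < 0) (p_gt0 : (0 < p)%N) (periodic : iter p f 0 = 0).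
Hypothesis x_neq0 : forall k, (0 < k < p)%N -> iter k f 0 != 0.

Let c24 : -2 <= c <= 1 / 4.
Proof. by case/andP: c_range => ? ?; apply/andP; split; lra. Qed.

(** The critical point attracts its neighbours: a point close to 0, but distinct
    from 0, is mapped by the p-th iterate to a nonzero point at least as close
    to 0, and never reaches 0. *)
Lemma preimage0_isolated : exists2 d : R, 0 < d &
  forall z, z != 0 -> preimage0 c z -> d <= `|z|.
Proof.
have [m [m0 m1 hm]] : exists m : R, [/\ 0 < m, m <= 1 &
    forall k, (0 < k < p)%N -> m <= `|iter k f 0|].
  pose F (i : 'I_p) := if (0 < i)%N then `|iter i f 0| else 1.
  exists (\big[Order.min/1]_(i : 'I_p) F i); split.
  - apply: lt_bigmin => // i _; rewrite /F; case: ifP => // i0.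
    by rewrite normr_gt0 x_neq0 // i0 ltn_ord.
  - exact: bigmin_le_id.
  - move=> k /andP[k0 kp]; rewrite (le_trans (bigmin_le _ (Ordinal kp) _)) //.
    by rewrite /F /= k0.
have K0 : 0 < (4 : R) ^+ p by rewrite exprn_gt0.
have K1 : 1 <= (4 : R) ^+ p by rewrite exprn_ege1 // ler1n.
pose d := m / 4 ^+ p.
have d0 : 0 < d by rewrite divr_gt0.
have dK : 4 ^+ p * d = m by rewrite mulrC divfK ?gt_eqF.
have d1 : d <= m by rewrite ler_pdivrMr // ler_peMr // ltW.
have bge : 1 <= quad_beta c.
  case/andP: c_range => c2 c0.
  have c4 : c <= 1 / 4 by lra.
  by have := quad_beta_eq c4; have := quad_beta_ge_half c; move: (quad_beta c) => b; nra.
have dist z i : `|z| < d -> (0 < i <= p)%N -> `|iter i f z - iter i f 0| <= m * `|z|.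
  move=> zd /andP[i0 ip]; rewrite -(prednK i0).
  apply: (le_trans (iter_quad_critical_dist _ c24 _)); first by lra.
  rewrite -(real_normK (num_real z)) expr2 mulrA ler_wpM2r //.
  rewrite -dK; apply: ler_pM; rewrite ?exprn_ge0 ?(ltW zd) //.
  by rewrite ler_weXn2l ?ler1n // (leq_trans (leq_pred _)).
have away z i : `|z| < d -> (0 < i < p)%N -> iter i f z != 0.
  move=> zd ip; apply/eqP => iz.
  have := dist z i zd; rewrite iz sub0r normrN => h.
  have {}h : `|iter i f 0| <= m * `|z| by apply: h; case/andP: ip => -> /ltnW ->.
  have := hm i ip; have : m * `|z| < m * 1 by rewrite ltr_pM2l //; lra.
  by lra.
have ret z : z != 0 -> `|z| < d -> iter p f z != 0 /\ `|iter p f z| < d.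
  move=> z0 zd; split; last first.
    have := dist z p zd; rewrite p_gt0 leqnn periodic subr0 => /(_ isT) h.
    by apply: (le_lt_trans h); apply: le_lt_trans zd; rewrite ler_piMl.
  have nt : no_turning c p (Num.min 0 z) (Num.max 0 z).
    move=> [|i] w ip /andP[w1 w2].
      apply/eqP => /= w0; move: w1 w2; rewrite w0.
      by case: (lerP 0 z); lra.
    apply: away; last by rewrite ip.
    apply: le_lt_trans zd; rewrite ler_norml; move: w1 w2.
    case: (lerP 0 z) => hz w1 w2; first by rewrite ger0_norm //; lra.
    by rewrite ltr0_norm //; lra.
  have lt0z : Num.min 0 z < Num.max 0 z.
    by case: (lerP 0 z) => // hz; rewrite lt_neqAle eq_sym z0.
  have [e he] := no_turning_monotone lt0z nt (leqnn p).
  apply: contraTneq he => pz.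
  by case: (lerP 0 z) => _; rewrite periodic pz subrr mulr0 ltxx.
exists d => // z z0 [j hj]; rewrite leNgt; apply/negP => zd.
elim/ltn_ind: j z z0 zd hj => j IHj z z0 zd hj.
have [jp|pj] := ltnP j p.
  have [j0|j0] := eqVneq j 0%N; first by move: hj z0; rewrite j0 /= => ->; rewrite eqxx.
  by have := away z j zd; rewrite lt0n j0 jp hj eqxx => /(_ isT).
have [h1 h2] := ret z z0 zd.
apply: (IHj (j - p)%N _ (iter p f z)) => //; last by rewrite -iterD subnK.
by rewrite ltn_subrL p_gt0 (leq_trans p_gt0).
Qed.

Lemma iter_first_diff (x y : R) i : x != y -> iter i f x = iter i f y ->
  exists2 k, (k < i)%N & iter k f x != iter k f y /\ iter k.+1 f x = iter k.+1 f y.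
Proof.
move=> xy; elim: i => [/eqP|i IHi hi]; first by rewrite (negPf xy).
have [/IHi[k ki hk]|ne] := eqVneq (iter i f x) (iter i f y).
  by exists k => //; rewrite ltnW.
by exists i.
Qed.

(** If x reaches 0 first, the image of y at that time is a nonzero preimage of 0,
    hence not small.  If both are at 0 at the same time, look at the last time
    where they differ: they are opposite and not small. *)
Lemma turning_points_separated : exists2 d : R, 0 < d & forall n x y,
  x \in turning_points c n -> y \in turning_points c n -> x != y ->
  exists2 k, (k < n)%N & d <= `|iter k f x - iter k f y|.
Proof.
have [d d0 hd] := preimage0_isolated; exists d => // n x y.
move=> /mem_turning_points[i i_n hx] /mem_turning_points[j j_n hy] xy.
have py : preimage0 c y by exists j.
have px : preimage0 c x by exists i.
have [e|ne] := eqVneq (iter i f x) (iter i f y).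
  have [k ki [ne /eqP]] := iter_first_diff xy e.
  rewrite !iterS -subr_eq0 quadB mulf_eq0 subr_eq0 (negPf ne) /= addr_eq0 => /eqP xE.
  exists k; first exact: ltn_trans ki i_n.
  have x0 : iter k f x != 0.
    by apply: contraNneq ne => h; move: xE; rewrite h => /eqP; rewrite eq_sym oppr_eq0 => /eqP ->.
  have -> : iter k f y = - iter k f x by rewrite xE opprK.
  rewrite opprK -mulr2n normrMn.
  have := hd _ x0 (preimage0_iter p_gt0 periodic k px).
  by rewrite mulr2n; have := normr_ge0 (iter k f x); lra.
exists i => //; rewrite hx sub0r normrN; apply: hd; first by rewrite -hx eq_sym.
exact: (preimage0_iter p_gt0 periodic i py).
Qed.

Definition lap_sign (k : nat) (x : R) : R := \prod_(i < k) Num.sg (iter i f x).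

(** On a lap, where the signs are constant, this function is increasing and
    measures the sum of the distances of the first n images. *)
Definition signed_sum (n : nat) (x : R) : R := \sum_(k < n) lap_sign k x * iter k f x.

Lemma lap_sign_le1 k x : `|lap_sign k x| <= 1.
Proof.
rewrite /lap_sign; elim: k => [|k IHk]; first by rewrite big_ord0 normr1.
rewrite big_ord_recr /= normrM mulr_ile1 // normr_sg.
by case: (_ != _).
Qed.

Lemma signed_sum_le n x : `|x| <= quad_beta c -> `|signed_sum n x| <= n%:R * quad_beta c.
Proof.
move=> hx; rewrite /signed_sum; elim: n => [|n IHn].
  by rewrite big_ord0 normr0 mul0r.
rewrite big_ord_recr /= (le_trans (ler_normD _ _)) // [n.+1%:R]mulrSr mulrDl mul1r lerD //.
by rewrite normrM (le_trans _ (iter_quad_bounded n c24 hx)) // ler_piMl ?lap_sign_le1.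
Qed.

Lemma same_lap n x y : x < y -> no_turning c n x y ->
  x \notin turning_points c n -> y \notin turning_points c n ->
  signed_sum n y - signed_sum n x = \sum_(k < n) `|iter k f y - iter k f x|.
Proof.
move=> xy nt xZ yZ.
have n0 z i : z \notin turning_points c n -> (i < n)%N -> iter i f z != 0.
  by move=> zZ i_n; apply: contraNneq zZ => h; apply/mem_turning_points; exists i.
have key k : (k <= n)%N -> lap_sign k x = lap_sign k y /\
   lap_sign k x * (iter k f y - iter k f x) = `|iter k f y - iter k f x|.
  elim: k => [_|k IHk kn].
    by rewrite /lap_sign !big_ord0 mul1r /= gtr0_norm // subr_gt0.
  have [e1 e2] := IHk (ltnW kn).
  have [sgE nE] : Num.sg (iter k f x) = Num.sg (iter k f y) /\
      Num.sg (iter k f x) * (iter k f y + iter k f x) = `|iter k f y + iter k f x|.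
    apply: same_sign_sg.
    rewrite lt_neqAle (no_turning_same_side (ltW xy) nt kn) andbT eq_sym.
    by rewrite mulf_neq0 ?n0.
  split; first by rewrite /lap_sign !big_ord_recr /= -/(lap_sign k x) -/(lap_sign k y) e1 sgE.
  rewrite /lap_sign big_ord_recr /= -/(lap_sign k x) quadB normrM -e2 -nE.
  ring.
rewrite /signed_sum -sumrB; apply: eq_bigr => k _.
have [e1 e2] := key k (ltnW (ltn_ord k)).
by rewrite -e1 -mulrBr e2.
Qed.

End Periodic.

(** * Topological entropy *)

Lemma size_le_inj (T : eqType) (U : finType) (g : T -> U) (s : seq T) :
  uniq s -> {in s &, injective g} -> (size s <= #|U|)%N.
Proof.
move=> us gi; rewrite -(size_map g) -(card_uniqP _) ?max_card //.
by rewrite map_inj_in_uniq.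
Qed.

(** The number of elements of [s] below a point identifies its lap. *)
Lemma same_count_no_between (R : realDomainType) (s : seq R) (x y : R) : x < y ->
  count (< x) s = count (< y) s -> forall z, z \in s -> ~~ (x <= z < y).
Proof.
move=> xy; elim: s => [//|w s IHs] /=.
have mono : (count (< x) s <= count (< y) s)%N.
  by apply: sub_count => z /= /lt_trans; apply.
case: (ltP w x) => wx /=.
  rewrite (lt_trans wx xy) /= => /addnI /IHs h z; rewrite inE => /orP[/eqP ->|/h //].
  by rewrite leNgt wx.
case: (ltP w y) => wy /=; first by move=> e; move: mono; rewrite add0n add1n in e; rewrite e ltnn.
rewrite !add0n => /IHs h z; rewrite inE => /orP[/eqP ->|/h //].
by rewrite [w < y]ltNge wy andbF.
Qed.

(** Separated points on the same lap differ by at least e in [signed_sum], whose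
    range has length 2 n beta.  So a point is determined by its lap and by the
    integer part of [signed_sum] / e; turning points are recorded
    separately. *)
Lemma separated_card_le (R : realType) (c : R) (n : nat) (e : R) (E : seq R) :
  -2 <= c < 0 -> 0 < e -> uniq E -> (forall x, x \in E -> `|x| <= quad_beta c) ->
  (forall x y, x \in E -> y \in E -> x != y ->
     exists2 k, (k < n)%N & e <= `|iter k (quad c) x - iter k (quad c) y|) ->
  (size E <= (size (turning_points c n)).+1 * (Num.truncn (4 * n%:R / e)).+2)%N.
Proof.
move=> hc e0 uE hE sepE; set Z := turning_points c n; set N := Num.truncn _.
have c24 : -2 <= c <= 1 / 4 by case/andP: hc => ? ?; apply/andP; split; lra.
have b2 := quad_beta_le2 c24.
pose F x := (signed_sum c n x + n%:R * quad_beta c) / e.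
have F0 x : x \in E -> 0 <= F x <= 4 * n%:R / e.
  move=> /hE /(signed_sum_le hc n); rewrite ler_norml => /andP[h1 h2].
  have h3 : n%:R * quad_beta c <= n%:R * 2 by rewrite ler_wpM2l.
  apply/andP; split; first by rewrite divr_ge0 ?(ltW e0) //; lra.
  by rewrite ler_pM2r ?invr_gt0 //; lra.
(* ord0 marks the turning points, the other values are shifted by one *)
pose g x : 'I_(size Z).+1 * 'I_N.+2 :=
  if x \in Z then (inord (index x Z), ord0)
  else (inord (count (< x) Z), inord (Num.truncn (F x)).+1).
apply: (@leq_trans #|{: 'I_(size Z).+1 * 'I_N.+2}|); last first.
  by rewrite card_prod !card_ord.
apply: (size_le_inj (g := g)) => // x y xE yE.
wlog lt_xy : x y xE yE / x < y.
  move=> hw gxy; have [xy|xy|//] := ltgtP x y; first exact: hw.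
  by apply/esym; apply: hw.
have trF z : z \in E -> (Num.truncn (F z) < N.+1)%N.
  by move=> /F0 /andP[_ h]; rewrite ltnS le_truncn.
rewrite /g; case: (boolP (x \in Z)) => xZ; case: (boolP (y \in Z)) => yZ.
- move=> [/(congr1 val)]; rewrite /= !inordK ?ltnS ?index_size // => ei.
  by rewrite -(nth_index 0 xZ) ei nth_index.
- by move=> [_ /(congr1 val)]; rewrite /= inordK //; exact: trF.
- by move=> [_ /(congr1 val)]; rewrite /= inordK //; exact: trF.
move=> [/(congr1 val) e1 /(congr1 val) e2]; exfalso.
move: e1 e2; rewrite /= !inordK ?ltnS ?count_size //; try exact: trF.
move=> e1 [e2].
have nt : no_turning c n x y.
  move=> i z i_n /andP[xz zy]; apply/negP => /eqP hz.
  have zZ : z \in Z by apply/mem_turning_points; exists i.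
  by have := same_count_no_between lt_xy e1 zZ; rewrite (ltW xz) zy.
have diff := same_lap lt_xy nt xZ yZ.
have xy : y != x by rewrite gt_eqF.
have [k kn hk] := sepE y x yE xE xy.
have ge : e <= signed_sum c n y - signed_sum c n x.
  rewrite diff (bigD1 (Ordinal kn)) //= (le_trans hk) // lerDl sumr_ge0 //.
have F1 : 1 <= F y - F x.
  have -> : F y - F x = (signed_sum c n y - signed_sum c n x) / e by rewrite /F; lra.
  by rewrite ler_pdivlMr // mul1r.
have /andP[/truncn_itv/andP[p1 p2] _] := F0 x xE.
have /andP[/truncn_itv/andP[q1 q2] _] := F0 y yE.
by move: p1 p2 q1 q2; rewrite e2 [_.+1%:R]mulrSr; lra.
Qed.

Lemma limn_esup_ub (R : realType) (u : (\bar R)^nat) (v : \bar R) N :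
  (forall n, (N <= n)%N -> (u n <= v)%E) -> (limn_esup u <= v)%E.
Proof.
move=> h; rewrite /limn_esup limf_esupE.
apply: (@le_trans _ _ (ereal_sup (u @` [set n | (N <= n)%N]%classic))).
  by apply: ereal_inf_lbound; exists [set n | (N <= n)%N]%classic => //; exact: nbhs_infty_ge.
by apply: ge_ereal_sup => _ [n /= Nn <-]; exact: h.
Qed.

Lemma limn_esup_lb (R : realType) (u : (\bar R)^nat) (v : \bar R) N :
  (forall n, (N <= n)%N -> (v <= u n)%E) -> (v <= limn_esup u)%E.
Proof.
move=> h; rewrite /limn_esup limf_esupE.
apply: le_ereal_inf_tmp => _ [V [M _ HM] <-].
apply: (@le_trans _ _ (u (maxn N M))); first by apply: h; exact: leq_maxl.
by apply: ereal_sup_ubound; exists (maxn N M) => //; apply: HM; exact: leq_maxr.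
Qed.

Lemma inv_n_small (R : realType) (A eta : R) : 0 < eta ->
  exists N, forall n, (N < n)%N -> A / n%:R <= eta.
Proof.
move=> eta0; exists (Num.bound (`|A| / eta)) => n Nn.
have n0 : 0 < n%:R :> R by rewrite ltr0n (leq_ltn_trans _ Nn).
rewrite ler_pdivrMr // (le_trans (ler_norm A)) // mulrC -ler_pdivrMr //.
have := @archi_boundP R (`|A| / eta); rewrite divr_ge0 ?(ltW eta0) // => /(_ isT) h.
by rewrite (le_trans (ltW h)) // ler_nat ltnW.
Qed.

(** The factors n and A do not affect the exponential growth rate. *)
Lemma entropy_of_growth (R : realType) (T : pseudoMetricType R) (f : T -> T)
    (X : set T) (r : R) :
  1 < r ->
  (forall e, 0 < e -> exists2 A : R, 0 < A & forall n, (0 < n)%N ->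
     (separated_number f X n e <= (A * n%:R * r ^+ n)%:E)%E) ->
  (exists2 e : R, 0 < e & exists2 A : R, 0 < A & forall n, (1 < n)%N ->
     ((A * r ^+ n)%:E <= separated_number f X n e)%E) ->
  topological_entropy f X = (ln r)%:E.
Proof.
move=> r1 ub lb; have r0 : 0 < r by lra.
have lnrn n : ln (r ^+ n) = n%:R * ln r by rewrite lnXn // mulr_natl.
have sep0 n e : (0 <= separated_number f X n e)%E.
  apply: ereal_sup_ubound; exists fset0; last by rewrite cardfs0.
  by split=> [x|x y] /=; rewrite inE.
have dom0 (x : \bar R) : (0 <= x)%E -> x \in `[0%E, +oo%E].
  by move=> x0; rewrite in_itv /= x0 leey.
apply/eqP; rewrite eq_le; apply/andP; split.
  apply: ge_ereal_sup => _ [e /= e0 <-]; have [A A0 hA] := ub e e0.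
  apply/lee_addgt0Pr => eta eta0; rewrite -EFinD.
  have eta2 : 0 < eta / 2 by rewrite divr_gt0.
  have [N hN] := inv_n_small (ln A - ln (eta / 2)) eta2.
  apply: (@limn_esup_ub _ _ _ N.+1) => n Nn.
  have n0 : (0 < n)%N by rewrite (leq_ltn_trans _ Nn).
  have nR : 0 < n%:R :> R by rewrite ltr0n.
  have pos : 0 < A * n%:R * r ^+ n by rewrite !mulr_gt0 // exprn_gt0.
  apply: (@le_trans _ _ ((n%:R^-1)%:E * (ln (A * n%:R * r ^+ n))%:E)%E).
    rewrite lee_pmul2l ?fin_numE // ?lte_fin ?invr_gt0 // -lne_EFin //.
    rewrite lee_lne ?dom0 ?hA // lee_fin ltW //.
  rewrite -EFinM lee_fin ler_pdivrMl // !lnM ?posrE ?mulr_gt0 ?exprn_gt0 //.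
  rewrite lnrn.
  have lnn : ln n%:R <= eta / 2 * n%:R - ln (eta / 2).
    have : ln (eta / 2 * n%:R) <= eta / 2 * n%:R by rewrite ltW // ln_sublinear // mulr_gt0.
    by rewrite lnM ?posrE //; lra.
  have := hN n Nn; rewrite ler_pdivrMr //; lra.
have [e e0 [A A0 hA]] := lb.
apply: (@le_trans _ _ (limn_esup
  (fun n => ((n%:R^-1)%:E * lne (separated_number f X n e))%E))); last first.
  by apply: ereal_sup_ubound; exists e.
apply/lee_subgt0Pr => eta eta0; rewrite -EFinB.
have [N hN] := inv_n_small (- ln A) eta0.
apply: (@limn_esup_lb _ _ _ N.+2) => n Nn.
have n1 : (1 < n)%N by rewrite (leq_trans _ Nn).
have nR : 0 < n%:R :> R by rewrite ltr0n (ltn_trans _ n1).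
have pos : 0 < A * r ^+ n by rewrite !mulr_gt0 // exprn_gt0.
apply: (@le_trans _ _ ((n%:R^-1)%:E * (ln (A * r ^+ n))%:E)%E).
  rewrite -EFinM lee_fin ler_pdivlMl // lnM ?posrE ?exprn_gt0 // lnrn.
  by have := hN n (ltnW Nn); rewrite ler_pdivrMr //; lra.
rewrite lee_pmul2l ?fin_numE // ?lte_fin ?invr_gt0 // -lne_EFin //.
by rewrite lee_lne ?dom0 ?hA // lee_fin ltW.
Qed.

(** The exponential growth of the number of turning points is that of separated
    sets. *)
Lemma growth_rate_kneading (R : realType) (c t : R) (p : nat) (u : nat -> R) :
  -2 <= c < 0 -> 0 < t < 1 -> (0 < p)%N -> iter p (quad c) 0 = 0 ->
  (forall k, (0 < k < p)%N -> iter k (quad c) 0 != 0) ->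
  u p = 0 ->
  (forall k, (0 < k < p)%N -> u k = Num.sg (iter k (quad c) 0) * (1 + t * u k.+1)) ->
  1 + t * u 1%N = 0 -> (forall k, (1 < k <= p)%N -> 0 < 1 + t * u k) ->
  growth_rate c = t^-1.
Proof.
move=> hc ht p0 per x0 up urec u1 ugt; have /andP[t0 t1] := ht.
have c24 : -2 <= c <= 1 / 4 by case/andP: hc => ? ?; apply/andP; split; lra.
have [C C0 hC] := size_turning_points_le hc ht p0 per up urec u1 ugt.
have [B B0 hB] := size_turning_points_ge hc ht p0 per up urec u1 ugt.
have r1 : 1 < t^-1 by rewrite invf_gt1.
suff entE : quad_entropy c = (ln t^-1)%:E.
  by rewrite /growth_rate entE /= lnK // posrE invr_gt0.
apply: entropy_of_growth => //.
- move=> e e0; exists ((C + 1) * (4 / e + 2)).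
    by rewrite mulr_gt0 ?addr_gt0 // divr_gt0.
  move=> n n0; apply: ge_ereal_sup => _ [E /= [EX Esep] <-]; rewrite lee_fin.
  have hE x : x \in enum_fset E -> `|x| <= quad_beta c.
    by move=> xE; have := EX x xE; rewrite /quad_interval /= in_itv /= ler_norml.
  have sepE x y : x \in enum_fset E -> y \in enum_fset E -> x != y ->
      exists2 k, (k < n)%N & e <= `|iter k (quad c) x - iter k (quad c) y|.
    move=> xE yE xy; have [k kn hk] := Esep x y xE yE xy; exists k => //.
    by rewrite leNgt; apply/negP => lt; apply: hk; rewrite -ball_normE.
  have := separated_card_le hc e0 (fset_uniq E) hE sepE.
  rewrite -(ler_nat R) natrM => h; apply: (le_trans h).
  have tn : 1 <= t^-1 ^+ n by rewrite exprn_ege1 // ltW.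
  have h1 : (size (turning_points c n)).+1%:R <= (C + 1) * t^-1 ^+ n.
    by rewrite mulrSr mulrDl mul1r lerD //; rewrite exprVn; exact: hC.
  have nR : 1 <= n%:R :> R by rewrite ler1n.
  have h2 : (Num.truncn (4 * n%:R / e)).+2%:R <= (4 / e + 2) * n%:R.
    have q0 : 0 <= 4 * n%:R / e by rewrite divr_ge0 ?(ltW e0) // mulr_ge0.
    have /andP[q _] := truncn_itv q0.
    rewrite -[(Num.truncn _).+2]addn2 natrD [leRHS]mulrDl lerD //; last by rewrite ler_peMr.
    by rewrite (le_trans q) // mulrAC.
  have -> : (C + 1) * (4 / e + 2) * n%:R * t^-1 ^+ n =
     (C + 1) * t^-1 ^+ n * ((4 / e + 2) * n%:R) by ring.
  by apply: ler_pM.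
- have [d d0 hd] := turning_points_separated hc p0 per x0.
  exists d => //; exists B => // n n1; rewrite exprVn.
  apply: (@le_trans _ _ ((size (turning_points c n))%:R)%:E); first by rewrite lee_fin hB.
  apply: ereal_sup_ubound => /=; exists (seq_fset tt (turning_points c n)).
    have memE z : (z \in seq_fset tt (turning_points c n)) = (z \in turning_points c n).
      exact: seq_fsetE.
    split=> [x|x y]; rewrite /= !memE.
      move=> /mem_turning_points[i _ hi].
      have : `|x| <= quad_beta c by apply: preimage0_le_beta => //; exists i.
      by rewrite /quad_interval /= in_itv /= ler_norml.
    move=> xZ yZ xy; have [k kn hk] := hd n x y xZ yZ xy; exists k => //.
    by rewrite -ball_normE /ball_ /= => h; move: hk; rewrite leNgt h.
  rewrite size_seq_fset undup_id // (sorted_uniq lt_trans ltxx) //.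
  exact: sorted_turning_points.
Qed.

(** * Conjugates of growth rates *)

Definition rev_word (p : nat) (a : nat -> bool) (k : nat) : bool := a (p.-1 - k)%N.

Lemma horner_sign_poly (K : nzRingType) a p (z : K) :
  (sign_poly K a p).[z] = \sum_(k < p) (-1) ^+ a k * z ^+ k.
Proof.
rewrite (horner_coef_wide _ (n := p)) ?size_sign_poly //.
by apply: eq_bigr => k _; rewrite coef_sign_poly ltn_ord.
Qed.

Lemma horner_rev_word (K : fieldType) a p (z : K) : z != 0 ->
  (sign_poly K (rev_word p a) p).[z] = z ^+ p.-1 * (sign_poly K a p).[z^-1].
Proof.
move=> z0; rewrite !horner_sign_poly mulr_sumr (reindex_inj rev_ord_inj) /=.
apply: eq_bigr => k _; rewrite /rev_word.
have kp := ltn_ord k; have -> : (p.-1 - (p - k.+1) = k)%N by lia.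
rewrite mulrCA; congr (_ * _).
have -> : z ^+ p.-1 = z ^+ (p - k.+1) * z ^+ k by rewrite -exprD; congr (_ ^+ _); lia.
by rewrite exprVn mulfK // expf_neq0.
Qed.

Definition growth_conjugates (R : realType) : set R[i]^o :=
  \bigcup_(c in real_superattracting_parameters R)
    (galois_conjugates (growth_rate c)%:C : set R[i]^o).
Arguments growth_conjugates : clear implicits.

Lemma kneading_conjugates (R : realType) a n N L (z : R[i]) :
  dominant a (2 ^ n) N L -> ~~ (4 %| (sign_poly int a (2 ^ n)).[1])%Z ->
  root (sign_poly R[i] (rev_word (2 ^ n) a) (2 ^ n)) z ->
  growth_conjugates R z.
Proof.
move=> dom n4 rz; set p := (2 ^ n)%N in dom n4 rz *.
have [a0 aN Np [NL L1] _] := dom.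
have p0 : (0 < p)%N by lia.
have n0 : (0 < n)%N by move: Np NL L1; rewrite /p; case: (n) => //; rewrite expn0; lia.
have [c [c27 per sgx]] := quad_parameter R dom.
have [t [u [t01 rt u1 up [urec ugt]]]] := tent_orbit R dom.
have cneg : -2 <= c < 0 by case/andP: c27 => -> ?; apply/andP; split => //; lra.
have gr : growth_rate c = t^-1.
  apply: (growth_rate_kneading cneg t01 p0 per _ up _ u1 ugt).
    by move=> k kp; rewrite -sgr_eq0 sgx // signr_eq0.
  by move=> k kp; rewrite sgx // urec.
exists c.
  split; first by case/andP: cneg => ? ?; apply/andP; split; lra.
  by exists p.
exists (sign_poly rat (rev_word p a) p); last by rewrite map_sign_poly.
have irr : irreducible_poly (sign_poly rat (rev_word p a) p).
  apply: sign_poly_irreducible => //; rewrite (_ : _.[1] = (sign_poly int a p).[1]) //.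
  rewrite !horner_sign_poly (reindex_inj rev_ord_inj) /=; apply: eq_bigr => k _.
  rewrite !expr1n /rev_word; congr (_ ^+ (a _) * _).
  by have := ltn_ord k; rewrite -/p; lia.
have tn0 : t != 0 by rewrite gt_eqF //; case/andP: t01.
have rt' : root (map_poly ratr (sign_poly rat (rev_word p a) p)) (growth_rate c)%:C.
  rewrite map_sign_poly -(map_sign_poly (real_complex R)) fmorph_root gr.
  by rewrite rootE horner_rev_word ?invr_eq0 // invrK (rootP rt) mulr0.
split => //.
- rewrite monicE -(prednK p0) lead_coef_sign_poly /rev_word prednK // subnn a0.
  by rewrite expr0.
- by move=> q q0 rq; apply: irreducible_min_size irr rt' q0 rq.
Qed.

(** Changing one sign changes the value at 1 by 2. *)
Lemma parity_bit (a : bool -> nat -> bool) p j : (j < p)%N ->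
  (forall b, a b j = b) -> (forall b k, k != j -> a b k = a false k) ->
  exists b, ~~ (4 %| (sign_poly int (a b) p).[1])%Z.
Proof.
move=> jp aj ak.
have E b : (sign_poly int (a b) p).[1] =
    (-1) ^+ b + \sum_(k < p | k != Ordinal jp) (-1) ^+ a false k.
  rewrite horner_sign_poly (bigD1 (Ordinal jp)) //= aj expr1n mulr1; congr (_ + _).
  by apply: eq_bigr => k kj; rewrite expr1n mulr1 ak.
have [h0|h0] := boolP (4 %| (sign_poly int (a false) p).[1])%Z; last by exists false.
exists true; apply/negP => h1; move: h0 h1; rewrite !E expr0 expr1.
by move: (\sum_(_ < _ | _) _) => S; lia.
Qed.

(** The word consists of a plus sign, N minus signs, a free sign for the parity,
    and the reversed sequence [b]; the reversed polynomial has [b] as its low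
    coefficients. *)
Lemma approx_inside (R : realType) (z : R[i]) (b : nat -> bool) N L (e : R) :
  (3 * L.+1 <= N)%N -> (0 < L)%N -> short_runs L b 0 -> vanishes (sign_series R b) z ->
  z != 0 -> normc z < 1 -> 0 < e ->
  exists2 y : R[i], growth_conjugates R y & normc (y - z) < e.
Proof.
move=> NL L0 tb vb z0 z1 e0.
pose w n (bit : bool) k := if k == 0%N then false else if (k <= N)%N then true else
   if k == N.+1 then bit else b ((2 ^ n).-1 - k)%N.
have bits n : exists bit, (N.+1 < 2 ^ n)%N ->
    ~~ (4 %| (sign_poly int (w n bit) (2 ^ n)).[1])%Z.
  have [Nn|Nn] := ltnP N.+1 (2 ^ n); last by exists false.
  have [] := @parity_bit (w n) (2 ^ n) N.+1 Nn.
  - by move=> bit; rewrite /w /= ltnn eqxx.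
  - by move=> bit k kN; rewrite /w (negPf kN).
  - by move=> bit hbit; exists bit.
pose a n := w n (projT1 (cid (bits n))).
pose Q n := sign_poly R[i] (rev_word (2 ^ n) (a n)) (2 ^ n).
have [|||||||||n nN [x rx xz]] := @root_approx R (sign_series R b) Q z N.+2 N.+2 e.
- by move=> j; rewrite normc_sign.
- by rewrite signr_eq0.
- by [].
- by [].
- by [].
- by move=> n; rewrite size_sign_poly.
- move=> n j; rewrite coef_sign_poly; case: ifP => _; rewrite ?normc_sign ?normc0 //.
- move=> n j jN; rewrite coef_sign_poly ifT; last by lia.
  rewrite /rev_word /a /w /sign_series !ifN ?subKn //; lia.
- by [].
exists x => //.
have Nn : (N.+2 < 2 ^ n)%N by rewrite (leq_ltn_trans nN) // ltn_expl.
apply: (@kneading_conjugates R (a n) n N L.+1) => //; last first.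
  by rewrite /a; case: (cid _) => bit /= ->; lia.
split.
- by rewrite /a /w.
- by move=> k /andP[k0 kN]; rewrite /a /w kN; case: k k0 kN.
- by nlia.
- by split; nlia.
move=> k Nk kL.
have aE j : (N.+1 < j < 2 ^ n)%N -> a n j = b ((2 ^ n).-1 - j)%N.
  by move=> jN; rewrite /a /w !ifN //; nlia.
(* the window may start at the free sign *)
pose k' := if k == N.+1 then k.+1 else k.
have [k'1 k'2 k'3] : [/\ (N.+1 < k')%N, (k <= k')%N & (k' <= k.+1)%N].
  by rewrite /k'; case: ifP => [/eqP ->|/negP h]; split; nlia.
pose m := ((2 ^ n).-1 - (k' + L.-1))%N.
have [i iL hi] := tb m isT.
have e1 : a n (k' + L.-1)%N = b m by rewrite aE //; nlia.
have e2 : a n (k' + L.-1 - i)%N = b (m + i)%N.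
  rewrite aE; last by nlia.
  by congr b; rewrite /m; nlia.
have [e3|e3] := eqVneq (a n (k' + L.-1)%N) (a n k).
  exists (k' + L.-1 - i - k)%N; first by nlia.
  by rewrite subnKC; [rewrite -e3 e1 e2 | nlia].
by exists (k' + L.-1 - k)%N; [nlia | rewrite subnKC //; nlia].
Qed.

(** The word is an initial segment of [s], whose last sign is free for the
    parity; 1/z is close to a root of the polynomial of this word. *)
Lemma approx_outside (R : realType) (z : R[i]) (s : nat -> bool) N L (e : R) :
  (3 * L.+1 <= N)%N -> (0 < L)%N -> s 0%N = false ->
  (forall k, (0 < k <= N)%N -> s k = true) -> short_runs L s N.+1 ->
  vanishes (sign_series R s) z^-1 ->
  1 < normc z -> 0 < e ->
  exists2 y : R[i], growth_conjugates R y & normc (y - z) < e.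
Proof.
move=> NL L0 s0 sN ts vs z1 e0.
have z0 : z != 0 by rewrite -normc_gt0; lra.
pose w n (bit : bool) k := if k == (2 ^ n).-1 then bit else s k.
have p0 n : (0 < 2 ^ n)%N by rewrite expn_gt0.
have bits n : exists bit, ~~ (4 %| (sign_poly int (w n bit) (2 ^ n)).[1])%Z.
  have [] := @parity_bit (w n) (2 ^ n) (2 ^ n).-1; first by rewrite prednK.
  - by move=> bit; rewrite /w eqxx.
  - by move=> bit k kN; rewrite /w (negPf kN).
  - by move=> bit hbit; exists bit.
pose a n := w n (projT1 (cid (bits n))).
pose Q n := sign_poly R[i] (a n) (2 ^ n).
have zV0 : 0 < normc z^-1 by rewrite normc_gt0 invr_eq0.
have zV1 : normc z^-1 < 1 by rewrite normcV invf_lt1 //; lra.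
(* near 1/z inversion multiplies distances by at most 2 / |1/z|^2 *)
pose d := Num.min (normc z^-1 / 2) (e * normc z^-1 ^+ 2 / 4).
have d0 : 0 < d by rewrite lt_min !divr_gt0 // mulr_gt0 // exprn_gt0.
have [|||||||||n nN [x rx xz]] := @root_approx R (sign_series R s) Q z^-1 1 N.+2 d.
- by move=> j; rewrite normc_sign.
- by rewrite signr_eq0.
- by rewrite invr_eq0.
- by [].
- by [].
- by move=> n; rewrite size_sign_poly.
- move=> n j; rewrite coef_sign_poly; case: ifP => _; rewrite ?normc_sign ?normc0 //.
- move=> n j jN; rewrite coef_sign_poly ifT; last by lia.
  by rewrite /a /w /sign_series ifN //; lia.
- by [].
have Nn : (N.+2 < 2 ^ n)%N by rewrite (leq_ltn_trans nN) // ltn_expl.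
have [d1 d2] : d <= normc z^-1 / 2 /\ d <= e * normc z^-1 ^+ 2 / 4.
  by split; rewrite ge_min lexx ?orbT.
have xge : normc z^-1 / 2 <= normc x.
  by have := normc_le_dist z^-1 x; rewrite normcBC; lra.
have x0 : x != 0 by rewrite -normc_gt0; lra.
exists x^-1.
  apply: (@kneading_conjugates R (a n) n N L.+1) => //; last first.
  - by rewrite rootE horner_rev_word ?invr_eq0 // invrK (rootP rx) mulr0.
  - by rewrite /a; case: (cid _).
  have aE j : (j < (2 ^ n).-1)%N -> a n j = s j.
    by move=> jn; rewrite /a /w ifN //; nlia.
  split.
  - by rewrite aE //; nlia.
  - by move=> k kN; rewrite aE ?sN //; nlia.
  - by nlia.
  - by split; nlia.
  move=> k Nk kL; have [i iL hi] := ts k Nk.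
  by exists i; [nlia | rewrite !aE //; nlia].
have -> : x^-1 - z = (z^-1 - x) / (x * z^-1).
  rewrite mulrBl -{1}[x]mulr1; field; exact/andP.
rewrite normcM normcV normcM ltr_pdivrMr ?mulr_gt0 ?normc_gt0 ?invr_eq0 // normcBC.
apply: (lt_le_trans xz); apply: (le_trans d2).
have : normc z^-1 / 2 * normc z^-1 <= normc x * normc z^-1 by rewrite ler_pM2r.
have : 0 <= normc z^-1 * normc z^-1 by rewrite mulr_ge0 ?normc_ge0.
move=> h1 h2; rewrite expr2 -mulrA ler_pM2l //; lra.
Qed.

Theorem proposition6p1 (R : realType) :
  exists2 r : R, 1 < r &
    [set z : R[i]^o | (r^-1)%:C < `|z| < r%:C] `<=` entropy_spectrum R.
Proof.
have [rho /andP[rho0 rho1] zeros] := sign_series_zeros R.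
exists rho^-1; first by rewrite invf_gt1.
move=> z /= /andP[]; rewrite invrK => z_gt z_lt.
have {}z_gt : rho < normc (z : R[i]) by rewrite -ltcR.
have {}z_lt : normc (z : R[i]) < rho^-1 by rewrite -ltcR.
have off_circle (w : R[i]) e : normc w != 1 -> rho < normc w < rho^-1 -> 0 < e ->
  exists2 y : R[i], growth_conjugates R y & normc (y - w) < e.
  move=> w1 /andP[w_gt w_lt] e0.
  have w0 : w != 0 by rewrite -normc_gt0; lra.
  have [lt1|gt1|eq1] := ltgtP (normc w) 1; last by rewrite eq1 eqxx in w1.
    have [|N [L [NL L0 _ [b [tb vb]]]]] := zeros w; first by rewrite w_gt.
    exact: approx_inside NL L0 tb vb w0 lt1 e0.
  have [|N [L [NL L0 [s [s0 sN ts vs]] _]]] := zeros w^-1.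
    rewrite normcV invf_lt1 ?gt1 ?andbT; last by lra.
    by rewrite -[rho]invrK ltf_pV2 // posrE ?invr_gt0 //; lra.
  exact: approx_outside NL L0 s0 sN ts vs gt1 e0.
have approx e : 0 < e -> exists2 y : R[i], growth_conjugates R y & normc (y - z) < e.
  move=> e0; have [z1|z1] := eqVneq (normc (z : R[i])) 1; last first.
    by apply: off_circle => //; rewrite z_gt.
  (* points of the unit circle are approached from inside *)
  pose h := Num.min (e / 2) ((1 - rho) / 2).
  have h0 : 0 < h by rewrite lt_min !divr_gt0 // subr_gt0.
  have [h1 h2] : h <= e / 2 /\ h <= (1 - rho) / 2.
    by split; rewrite ge_min lexx ?orbT.
  pose w : R[i] := z * (1 - h)%:C.
  have wn : normc w = 1 - h.
    by rewrite normcM z1 mul1r normc_real ger0_norm //; lra.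
  have e2 : 0 < e / 2 by lra.
  have [||y hy yw] := off_circle w (e / 2) _ _ e2.
  - by rewrite wn lt_eqF //; lra.
  - rewrite wn; apply/andP; split; first by lra.
    by rewrite (@lt_trans _ _ 1) ?invf_gt1 //; lra.
  exists y => //; have := normc_le_dist (y - z) (y - w).
  have -> : y - z - (y - w) = - (z * h%:C).
    by rewrite /w rmorphB /= rmorph1; ring.
  by rewrite normcN normcM z1 mul1r normc_real gtr0_norm //; lra.
move=> B /nbhs_ballP[e /= e0 eB].
have eE : e = (complex.Re e)%:C by rewrite RRe_real // gtr0_real.
have Re0 : 0 < complex.Re e by move: e0; rewrite {1}eE -ltcR.
have [y hy yz] := approx _ Re0.
exists y; split => //; apply: eB.
rewrite -ball_normE /ball_ /= eE distrC.
by rewrite -ltcR in yz.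
Qed.
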